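(* Let $M\in\mathbb{R}^{m\times n}$ be a nonzero matrix, let $f:\mathbb{R}^n\to\left]-\infty,+\infty\right]$ be proper, lower semicontinuous and $\alpha$-convex, and let $g:\mathbb{R}^m\to\left]-\infty,+\infty\right]$ be proper, lower semicontinuous and $\beta$-convex, where $\alpha,\beta\in\mathbb{R}$ satisfy $\alpha\ge0$ and $\alpha+\beta\|M\|^2\ge0$. Let $(\mathcal P)$ denote the problem $\min\{f(x)+g(z):Mx=z,\ x\in\mathbb{R}^n,\ z\in\mathbb{R}^m\}$. Suppose that one of the following conditions holds: (A.1) the Lagrangian $L_0$ has a critical point; (A.2) the Lagrangian $L_0$ has a saddle point; (A.3) problem $(\mathcal P)$ has an optimal solution and $0\in\operatorname{ri}(\operatorname{dom} g-M(\operatorname{dom} f))$; and that one of the following conditions holds: (B.1) $0\in\operatorname{ri}(\operatorname{dom} f^*-\operatorname{ran} M^T)$; (B.2) $\operatorname{ri}(\operatorname{ran}\partial f)\cap\operatorname{ran} M^T\ne\varnothing$; (B.3) $(\operatorname{rec} f)(x)>0$ for all $x\in\ker M\setminus\{x\in\mathbb{R}^n:-(\operatorname{rec} f)(-x)=(\operatorname{rec} f)(x)=0\}$; (B.4) $f$ is coercive (in particular, supercoercive); (B.5) $\alpha>0$ (i.e., $f$ is strongly convex); (B.6) $M^TM$ is invertible. Let $\delta>\max\{0,-2\beta\}$ and let $\gamma$ be such that $$\gamma=\delta+2\beta\quad\text{if }\alpha+\beta\|M\|^2=0,$$ $$\gamma\in\left]\max\{0,\delta+2\beta-\Delta_\delta\},\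 \delta+2\beta+\Delta_\delta\right[\quad\text{if }\alpha+\beta\|M\|^2>0,$$ where $\Delta_\delta:=\frac{1}{\|M\|}\sqrt{2(\alpha+\beta\|M\|^2)(\delta+2\beta)}$. Let $(x^0,z^0,y^0)\in\mathbb{R}^n\times\mathbb{R}^m\times\mathbb{R}^m$ and let $(x^k,z^k,y^k)_{k=0}^\infty$ be generated by the aADMM with parameters $\gamma,\delta$. Then $$Mx^k\to Mx^\star,\quad z^k\to z^\star\quad\text{and}\quad y^k\to y^\star,$$ where $(x^\star,z^\star,y^\star)$ is a critical point of $L_0$. Consequently, $(x^\star,z^\star)$ is a solution of $(\mathcal P)$. If, in particular, (B.5) or (B.6) holds, then $x^k\to x^\star$.
   Context: $\|M\|$ is the matrix $2$-norm. A function $h$ is $\alpha$-convex ($\alpha\in\mathbb{R}$) if $h-\frac{\alpha}{2}\|\cdot\|^2$ is convex. $\operatorname{dom} h=\{x:h(x)<+\infty\}$; $f^*(u)=\sup_x\{\langle u,x\rangle-f(x)\}$ is the Fenchel conjugate; $(\operatorname{rec} f)(y)=\sup_{x\in\operatorname{dom} f}\{f(x+y)-f(x)\}$ is the recession function. $f$ is coercive if $f(x)\to+\infty$ as $\|x\|\to\infty$, and supercoercive if $f(x)/\|x\|\to+\infty$ as $\|x\|\to\infty$. $\operatorname{ri}$ of a set is its relative interior (interior relative to its affine hull); $\operatorname{ran}$ and $\ker$ are range and null space; for a set-valued operator $A$, $\operatorname{ran} A=\bigcup_x A(x)$. For $\gamma\ge 0$ the augmented Lagrangian is $L_\gamma(x,z,y)=f(x)+g(z)+\langle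 y,Mx-z\rangle+\frac{\gamma}{2}\|Mx-z\|^2$; $L_0$ is the (unaugmented) Lagrangian. Convex subdifferential: $\partial f(x)=\{u:\langle y-x,u\rangle+f(x)\le f(y)\ \forall y\}$ for $x\in\operatorname{dom} f$. Fréchet subdifferential: $\widehat\partial g(z)=\{u:\liminf_{w\to z,\,w\ne z}\frac{g(w)-g(z)-\langle u,w-z\rangle}{\|w-z\|}\ge 0\}$ for $z\in\operatorname{dom} g$. Both are empty outside the domain. A triple $(x^\star,z^\star,y^\star)\in\mathbb{R}^n\times\mathbb{R}^m\times\mathbb{R}^m$ is a critical point of $L_0$ if $-M^Ty^\star\in\partial f(x^\star)$, $y^\star\in\widehat\partial g(z^\star)$ and $Mx^\star-z^\star=0$. It is a saddle point of $L_0$ if $L_0(x^\star,z^\star,y)\le L_0(x^\star,z^\star,y^\star)\le L_0(x,z,y^\star)$ for all $(x,z,y)\in\mathbb{R}^n\times\mathbb{R}^m\times\mathbb{R}^m$. The aADMM (adaptive alternating direction method of multipliers) with parameters $\gamma,\delta>0$ and initial point $(x^0,z^0,y^0)$ iterates, for $k=0,1,2,\dots$: $x^{k+1}$ is a minimizer of $x\mapsto L_\gamma(x,z^k,y^k)$ over $\mathbb{R}^n$; $z^{k+1}$ is a minimizer of $z\mapsto L_\delta(x^{k+1},z,y^k)$ over $\mathbb{R}^m$; $y^{k+1}=y^k+\delta(Mx^{k+1}-z^{k+1})$.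
   Formalization: The x-update minimizes f(x)+⟨y^k,Mx−z^k⟩+(γ/2)‖Mx−z^k‖², i.e. L_γ(x,z^k,y^k) without the constant g(z^k); if z^0 is outside dom g, L_γ(·,z^0,y^0) is identically +∞, every point is a minimizer, and the claim as stated can fail. *)

(* Defs.v *)
From HB Require Import structures.
From mathcomp Require Import all_boot all_order all_algebra.
From mathcomp Require Import all_classical all_reals all_analysis.
Set Implicit Arguments.
Unset Strict Implicit.
Unset Printing Implicit Defensive.
Import Order.TTheory GRing.Theory Num.Theory.
Import numFieldNormedType.Exports.
Local Open Scope classical_set_scope.
Local Open Scope ring_scope.

Definition dotp {R : realType} {n : nat} (u v : 'cV[R]_n) : R :=
  \sum_i u i 0 * v i 0.

(* The norm `|x| of the library on 'cV_n is the sup norm, hence a separate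
   Euclidean norm. Both induce the library topology of 'cV_n, which is used
   below for neighbourhoods, semicontinuity and convergence. *)
Definition enorm {R : realType} {n : nat} (x : 'cV[R]_n) : R :=
  Num.sqrt (dotp x x).

Definition opnorm {R : realType} {m n : nat} (M : 'M[R]_(m, n)) : R :=
  sup [set enorm (M *m x) | x in [set x : 'cV[R]_n | enorm x <= 1]].

Definition ranmx {R : realType} {m n : nat} (M : 'M[R]_(m, n)) :
  set 'cV[R]_m := range (fun x : 'cV[R]_n => M *m x).

Definition nullmx {R : realType} {m n : nat} (M : 'M[R]_(m, n)) :
  set 'cV[R]_n := [set x | M *m x = 0].

Definition set_sub {R : realType} {n : nat} (A B : set 'cV[R]_n) :
  set 'cV[R]_n := [set a - b | a in A & b in B].

Definition affine_set {R : realType} {n : nat} (A : set 'cV[R]_n) : Prop :=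
  forall x y (t : R), A x -> A y -> A (t *: x + (1 - t) *: y).

Definition aff_hull {R : realType} {n : nat} (A : set 'cV[R]_n) :
  set 'cV[R]_n := smallest affine_set A.

Definition relint {R : realType} {n : nat} (A : set 'cV[R]_n) :
  set 'cV[R]_n := [set x | A x /\ within (aff_hull A) (nbhs x) A].

Section ExtendedRealFunctions.
Context {R : realType} {n : nat}.
Implicit Types (h : 'cV[R]_n -> \bar R) (x u : 'cV[R]_n).
Local Open Scope ereal_scope.

Definition edom h : set 'cV[R]_n := [set x | h x < +oo].

Definition eproper h : Prop := (forall x, -oo < h x) /\ edom h !=set0.

(* Meant for functions that never take the value -oo (-oo + +oo is -oo in the
   library). *)
Definition econvex h : Prop :=
  forall x y (t : R), (0 < t < 1)%R ->
    h (t *: x + (1 - t) *: y)%R <= t%:E * h x + (1 - t)%:E * h y.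

Definition alpha_convex (alpha : R) h : Prop :=
  econvex (fun x => h x - (alpha / 2 * enorm x ^+ 2)%:E).

Definition fenchel_conj h u : \bar R :=
  ereal_sup [set (dotp u x)%:E - h x | x in [set: 'cV[R]_n]].

Definition recession h (d : 'cV[R]_n) : \bar R :=
  ereal_sup [set h (x + d)%R - h x | x in edom h].

Definition coercive h : Prop :=
  forall A : R, exists r : R, forall x, (r < enorm x)%R -> A%:E < h x.

Definition minimizer h x : Prop := forall x', h x <= h x'.

Definition subdiff h x : set 'cV[R]_n :=
  [set u | edom h x /\ forall x', (dotp (x' - x)%R u)%:E + h x <= h x'].

(* z^' is the filter of punctured neighbourhoods of z. *)
Definition frechet_subdiff h (z : 'cV[R]_n) : set 'cV[R]_n :=
  [set u | edom h z /\
    0 <= limf_einf (fun w => (h w - h z - (dotp u (w - z)%R)%:E) *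
                             ((enorm (w - z)%R)^-1)%:E) z^'].

End ExtendedRealFunctions.

Section Splitting.
Context {R : realType} {m n : nat}.
Implicit Types (f : 'cV[R]_n -> \bar R) (g : 'cV[R]_m -> \bar R).
Implicit Types (M : 'M[R]_(m, n)) (x : 'cV[R]_n) (z y : 'cV[R]_m).

Definition aug_lagrangian f g M (gamma : R) x z y : \bar R :=
  (f x + g z +
   (dotp y (M *m x - z)%R + gamma / 2 * enorm (M *m x - z)%R ^+ 2)%:E)%E.

Definition lagrangian f g M := aug_lagrangian f g M 0.

Definition critical_point f g M x z y : Prop :=
  [/\ subdiff f x (- (M^T *m y)), frechet_subdiff g z y & M *m x - z = 0].

Definition saddle_point f g M x z y : Prop :=
  forall x' z' y',
    (lagrangian f g M x z y' <= lagrangian f g M x z y)%E /\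
    (lagrangian f g M x z y <= lagrangian f g M x' z' y)%E.

Definition optimal_solution f g M x z : Prop :=
  M *m x = z /\
  forall x' z', M *m x' = z' -> (f x + g z <= f x' + g z')%E.

(* The x-step minimizes the part of the augmented Lagrangian that depends on
   x: the constant g(z^k) is left out. If g(z^k) is finite this changes nothing
   (x_stepE). It matters only for an initial z^0 outside edom g, where the
   augmented Lagrangian is identically +oo in x, so that read literally every
   point would be a minimizer. *)
Definition x_step f M (gamma : R) z y x : Prop :=
  minimizer (fun u => aug_lagrangian f (fun=> 0%E) M gamma u z y) x.

Lemma x_stepE f g M (gamma : R) z y x : g z \is a fin_num ->
  x_step f M gamma z y x <->
  minimizer (fun u => aug_lagrangian f g M gamma u z y) x.
Proof.
move=> gz.
have E u : aug_lagrangian f g M gamma u z y =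
    (aug_lagrangian f (fun=> 0) M gamma u z y + g z)%E.
  by rewrite /aug_lagrangian adde0 addeAC.
by split=> H u; have := H u; rewrite !E leeD2rE.
Qed.

Definition aADMM f g M (gamma delta : R)
    (x : nat -> 'cV[R]_n) (z y : nat -> 'cV[R]_m) : Prop :=
  forall k : nat,
    [/\ x_step f M gamma (z k) (y k) (x k.+1),
        minimizer (fun w => aug_lagrangian f g M delta (x k.+1) w (y k))
          (z k.+1)
      & y k.+1 = y k + delta *: (M *m x k.+1 - z k.+1)].

Definition Delta M (alpha beta delta : R) : R :=
  (opnorm M)^-1 *
  Num.sqrt (2 * (alpha + beta * opnorm M ^+ 2) * (delta + 2 * beta)).

End Splitting.

(* Main.v *)
(* With p = M x, the x- and z-steps are exactly the inclusions
   - M^T (y + gamma (p' - z)) in df(x') and y' in dg(z'), so that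
   s = y + delta z satisfies s' - s = delta (p' - z). Let (x0, z0, y0) be a
   critical point and s0 = y0 + delta z0. The (strong or weak) monotonicity of the
   two subdifferentials bounds |s - s0|^2 - |s' - s0|^2 from below by a quadratic
   form in (z - z0, p' - z0), which the assumptions on gamma and delta make larger
   than a multiple of |p' - z|^2. Hence the s_k are Fejer monotone with respect to
   the critical points and p_(k+1) - z_k -> 0, and it remains to see that cluster
   points are critical. Only x_k may be unbounded; any of the conditions (B) implies
   that a direction of recession of f in ker M is a direction of constancy, and then
   x_k can be shortened without changing M x_k and f(x_k).
   Limits along an ultrafilter finer than \oo replace subsequences. *)
Require Import Defs.
From HB Require Import structures.
From mathcomp Require Import all_boot all_order all_algebra.
From mathcomp Require Import all_classical all_reals all_analysis.
From mathcomp Require Import ring lra.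
Import Order.TTheory GRing.Theory Num.Theory.
Import numFieldNormedType.Exports.
Local Open Scope classical_set_scope.
Local Open Scope ring_scope.

Set Implicit Arguments.
Unset Strict Implicit.
Unset Printing Implicit Defensive.

(** Both subdifferentials are replaced by one relation, [strong_subgrad c]: a quadratic minorant of
    curvature c touches the function at x with slope u. Since c may be negative, f and a nonconvex g
    are treated alike. For a c-convex function a local inequality with a quadratic error already
    implies the global one, so a minimizer of a penalized function yields a subgradient without any
    sum rule. The bounds on gamma are a determinant condition. With a = alpha / |M|^2 and A = delta
    + 2 beta, the quadratic form has determinant 2 (a + beta) A - (gamma - A)^2 = Delta^2 - (gamma -
    A)^2. If a + beta = 0, it is nonnegative only for gamma = A, where the form degenerates to A |p'
    - z|^2. Control of the gap p' - z alone therefore covers both cases. Under (A.3) a multiplier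
    has to be constructed. It is obtained by penalization and compactness instead of a separation
    theorem, after a change of the objective that makes each of its two parts convex. *)

Section InnerProduct.
Context {R : realType}.

(** * Euclidean inner product, norm and operator norm *)

Lemma dotpC n (x y : 'cV[R]_n) : dotp x y = dotp y x.
Proof. by apply: eq_bigr => i _; rewrite mulrC. Qed.

Lemma dotpDl n (x y z : 'cV[R]_n) : dotp (x + y) z = dotp x z + dotp y z.
Proof. by rewrite -big_split; apply: eq_bigr => i _; rewrite mxE mulrDl. Qed.

Lemma dotpZl n (a : R) (x y : 'cV[R]_n) : dotp (a *: x) y = a * dotp x y.
Proof. by rewrite mulr_sumr; apply: eq_bigr => i _; rewrite mxE mulrA. Qed.

Lemma dotpNl n (x y : 'cV[R]_n) : dotp (- x) y = - dotp x y.
Proof. by rewrite -scaleN1r dotpZl mulN1r. Qed.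

Lemma dotpDr n (x y z : 'cV[R]_n) : dotp z (x + y) = dotp z x + dotp z y.
Proof. by rewrite dotpC dotpDl ![dotp _ z]dotpC. Qed.

Lemma dotpZr n (a : R) (x y : 'cV[R]_n) : dotp y (a *: x) = a * dotp y x.
Proof. by rewrite dotpC dotpZl [dotp x y]dotpC. Qed.

Lemma dotpNr n (x y : 'cV[R]_n) : dotp y (- x) = - dotp y x.
Proof. by rewrite dotpC dotpNl [dotp x y]dotpC. Qed.

Definition dotpE := (@dotpDl, @dotpDr, @dotpZl, @dotpZr, @dotpNl, @dotpNr).

Lemma dotp0l n (x : 'cV[R]_n) : dotp 0 x = 0.
Proof. by rewrite -(scale0r 0) dotpZl mul0r. Qed.

Lemma dotp0r n (x : 'cV[R]_n) : dotp x 0 = 0.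
Proof. by rewrite dotpC dotp0l. Qed.

Lemma dotp_ge0 n (x : 'cV[R]_n) : 0 <= dotp x x.
Proof. by apply: sumr_ge0 => i _; rewrite -expr2 sqr_ge0. Qed.

Lemma coord_sqr_le n (x : 'cV[R]_n) i : x i 0 ^+ 2 <= dotp x x.
Proof.
rewrite /dotp (bigD1 i) //= -expr2 lerDl sumr_ge0 // => j _.
by rewrite -expr2 sqr_ge0.
Qed.

Lemma dotp_eq0 n (x : 'cV[R]_n) : dotp x x = 0 -> x = 0.
Proof.
move=> x0; apply/colP => i; have := coord_sqr_le x i.
by rewrite x0 mxE => h; apply/eqP; rewrite -sqrf_eq0 eq_le h sqr_ge0.
Qed.

Lemma dotp_gt0 n (x : 'cV[R]_n) : x != 0 -> 0 < dotp x x.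
Proof.
by move=> x0; rewrite lt_def dotp_ge0 andbT; apply: contra_neq x0 => /dotp_eq0.
Qed.

Lemma dotp_mulmx m n (M : 'M[R]_(m, n)) x y :
  dotp y (M *m x) = dotp (M^T *m y) x.
Proof.
have E k (u v : 'cV[R]_k) : dotp u v = (u^T *m v) 0 0.
  by rewrite mxE; apply: eq_bigr => i _; rewrite mxE.
by rewrite !E trmx_mul trmxK mulmxA.
Qed.

Lemma enorm_sqr n (x : 'cV[R]_n) : enorm x ^+ 2 = dotp x x.
Proof. by rewrite sqr_sqrtr ?dotp_ge0. Qed.

Lemma enorm_ge0 n (x : 'cV[R]_n) : 0 <= enorm x.
Proof. exact: sqrtr_ge0. Qed.

Lemma enorm0 n : enorm (0 : 'cV[R]_n) = 0.
Proof. by rewrite /enorm dotp0l sqrtr0. Qed.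

Lemma enorm_gt0 n (x : 'cV[R]_n) : x != 0 -> 0 < enorm x.
Proof. by move=> x0; rewrite sqrtr_gt0 dotp_gt0. Qed.

Lemma enormZ n (a : R) (x : 'cV[R]_n) : enorm (a *: x) = `|a| * enorm x.
Proof. by rewrite /enorm dotpE dotpE mulrA -expr2 sqrtrM ?sqr_ge0 // sqrtr_sqr. Qed.

Lemma enormN n (x : 'cV[R]_n) : enorm (- x) = enorm x.
Proof. by rewrite -scaleN1r enormZ normrN1 mul1r. Qed.

Lemma enorm_le n (x : 'cV[R]_n) r : 0 <= r -> (enorm x <= r) = (dotp x x <= r ^+ 2).
Proof. by move=> r0; rewrite -enorm_sqr ler_pXn2r ?nnegrE ?enorm_ge0. Qed.

Lemma dotp_le_enorm n (x y : 'cV[R]_n) : dotp x y <= enorm x * enorm y.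
Proof.
have [->|x0] := eqVneq x 0; first by rewrite dotp0l enorm0 mul0r.
have := dotp_ge0 (enorm y *: x - enorm x *: y).
rewrite !dotpE -!enorm_sqr [dotp y x]dotpC => h.
have [->|y0] := eqVneq y 0; first by rewrite dotp0r enorm0 mulr0.
have p : 0 < enorm x * enorm y by rewrite mulr_gt0 ?enorm_gt0.
rewrite -(ler_pM2l p); nra.
Qed.

Lemma normr_dotp n (x y : 'cV[R]_n) : `|dotp x y| <= enorm x * enorm y.
Proof.
by rewrite ler_norml dotp_le_enorm andbT lerNl -dotpNl -(enormN x) dotp_le_enorm.
Qed.

Lemma enormD n (x y : 'cV[R]_n) : enorm (x + y) <= enorm x + enorm y.
Proof.
rewrite enorm_le ?addr_ge0 ?enorm_ge0 // !dotpE sqrrD !enorm_sqr [dotp y x]dotpC.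
by have := dotp_le_enorm x y; lra.
Qed.

Lemma coord_le n (x : 'cV[R]_n) i : `|x i 0| <= enorm x.
Proof.
rewrite -(ler_pXn2r (ltn0Sn 1)) ?nnegrE ?enorm_ge0 //.
by rewrite enorm_sqr real_normK ?num_real // coord_sqr_le.
Qed.

(** The constant is the Frobenius norm, by Cauchy-Schwarz on each row. It makes the set in [opnorm]
    bounded, so that its [sup] is a true least upper bound, and it later controls the second-order
    terms of penalties. *)
Lemma mulmx_bounded m n (M : 'M[R]_(m, n)) :
  exists2 C, 0 <= C & forall x, enorm (M *m x) <= C * enorm x.
Proof.
pose C := Num.sqrt (\sum_i enorm (row i M)^T ^+ 2).
have s0 : 0 <= \sum_i enorm (row i M)^T ^+ 2.
  by apply: sumr_ge0 => i _; rewrite sqr_ge0.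
exists C => [|x]; first exact: sqrtr_ge0.
rewrite enorm_le ?mulr_ge0 ?sqrtr_ge0 ?enorm_ge0 // exprMn sqr_sqrtr //.
rewrite mulr_suml; apply: ler_sum => i _; rewrite -expr2 -exprMn.
have -> : (M *m x) i 0 = dotp (row i M)^T x.
  by rewrite mxE; apply: eq_bigr => j _; rewrite !mxE.
rewrite -real_normK ?num_real // ler_pXn2r ?nnegrE ?mulr_ge0 ?enorm_ge0 //.
exact: normr_dotp.
Qed.

Lemma opnorm_ub m n (M : 'M[R]_(m, n)) x : enorm (M *m x) <= opnorm M * enorm x.
Proof.
have [C C0 hC] := mulmx_bounded M.
have [->|x0] := eqVneq x 0; first by rewrite mulmx0 !enorm0 mulr0.
rewrite -ler_pdivrMr ?enorm_gt0 //.
have px := enorm_gt0 x0.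
apply: sup_upper_bound; last first.
  exists ((enorm x)^-1 *: x).
    by rewrite /= enormZ ger0_norm ?invr_ge0 ?enorm_ge0 // mulVf ?gt_eqF.
  by rewrite -scalemxAr enormZ ger0_norm ?invr_ge0 ?enorm_ge0 // mulrC.
split; first by exists (enorm (M *m 0)), 0 => //=; rewrite enorm0.
exists C => _ [u /= u1 <-]; apply: le_trans (hC u) _.
by rewrite -[leRHS]mulr1 ler_wpM2l.
Qed.

Lemma opnorm_gt0 m n (M : 'M[R]_(m, n)) : M != 0 -> 0 < opnorm M.
Proof.
move=> M0; have [x Mx] : exists x : 'cV_n, M *m x != 0.
  apply: contrapT => /forallNP h; move/eqP: M0; apply; apply/matrixP => i j.
  have /negP/negPn/eqP := h (delta_mx j 0).
  by rewrite -colE => /colP/(_ i); rewrite !mxE.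
have x0 : x != 0 by apply: contraNneq Mx => ->; rewrite mulmx0.
have := opnorm_ub M x; rewrite -(pmulr_lgt0 _ (enorm_gt0 x0)).
by apply: lt_le_trans; exact: enorm_gt0.
Qed.

Lemma dotp_mulmx_le m n (M : 'M[R]_(m, n)) x :
  dotp (M *m x) (M *m x) <= opnorm M ^+ 2 * dotp x x.
Proof.
rewrite -!enorm_sqr -exprMn ler_pXn2r ?nnegrE ?enorm_ge0 ?opnorm_ub //.
by apply: le_trans (opnorm_ub M x); exact: enorm_ge0.
Qed.

End InnerProduct.

(** * Convergence along filters, coordinatewise and in Euclidean distance *)

Section Convergence.
Context {R : realType} {T : Type} (F : set_system T) {FF : Filter F}.

Lemma cvg_coordP n (x : T -> 'cV[R]_n) (l : 'cV[R]_n) :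
  x @ F --> l <-> forall i, x t i 0 @[t --> F] --> l i 0.
Proof.
split=> [xl i|xl].
  by apply: (@cvg_comp _ _ _ x (fun M : 'cV[R]_n => M i 0) _ _ _ xl);
    exact: coord_continuous.
apply/cvgrPdist_lt => e e0.
have : \forall t \near F, forall i, `|l i 0 - x t i 0| < e.
  apply: filter_forall => i; have /cvgrPdist_lt := xl i; exact.
apply: filterS => t h; rewrite [ltLHS]/Num.norm /= mx_normrE.
by apply/bigmax_ltP; split=> // -[i j] _; rewrite ord1 !mxE.
Qed.

Lemma cvg_dotp n (x y : T -> 'cV[R]_n) (a b : 'cV[R]_n) :
  x @ F --> a -> y @ F --> b ->
  dotp (x t) (y t) @[t --> F] --> dotp a b.
Proof.
move=> /cvg_coordP xa /cvg_coordP yb.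
by apply: cvg_big => [|i _]; [exact: add_continuous|apply: cvgM].
Qed.

Lemma cvg_mulmx m n (M : 'M[R]_(m, n)) (x : T -> 'cV[R]_n) (a : 'cV[R]_n) :
  x @ F --> a -> M *m x t @[t --> F] --> M *m a.
Proof.
move=> /cvg_coordP xa; apply/cvg_coordP => i; rewrite mxE.
under eq_fun do rewrite mxE.
apply: cvg_big => [|j _]; [exact: add_continuous|apply: cvgM => //; exact: cvg_cst].
Qed.

(** Bridge between the sup-norm topology of the library and Euclidean estimates: each squared
    coordinate is at most the squared Euclidean length. *)
Lemma cvg_dotpP n (x : T -> 'cV[R]_n) (a : 'cV[R]_n) :
  x @ F --> a <-> dotp (x t - a) (x t - a) @[t --> F] --> (0 : R).
Proof.
split=> [xa|h].
  rewrite -(dotp0l (0 : 'cV[R]_n)) -(subrr a).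
  by apply: cvg_dotp; apply: cvgB => //; exact: cvg_cst.
apply/cvg_coordP => i; apply/cvgrPdist_lt => e e0.
have e2 : 0 < e ^+ 2 by rewrite exprn_gt0.
move/cvgrPdist_lt : h => /(_ _ e2); apply: filterS => t.
rewrite sub0r normrN ger0_norm ?dotp_ge0 // => h.
rewrite -(ltr_pXn2r (ltn0Sn 1)) ?nnegrE ?(ltW e0) //.
rewrite real_normK ?num_real //; apply: le_lt_trans h.
by have := coord_sqr_le (x t - a) i; rewrite !mxE -sqrrN opprB.
Qed.

End Convergence.

(** Bolzano-Weierstrass without subsequences: each coordinate pushes the ultrafilter to an
    ultrafilter on the compact interval [-r, r], which converges there. *)
Lemma bounded_ultra_cvg (R : realType) (T : Type) (U : set_system T)
    (UU : UltraFilter U) n (x : T -> 'cV[R]_n) r :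
  (\forall t \near U, enorm (x t) <= r) -> exists l : 'cV[R]_n, x @ U --> l.
Proof.
move=> xr.
have h i : exists a : R, x t i 0 @[t --> U] --> a.
  pose V := x t i 0 @[t --> U].
  have VU : UltraFilter V.
    split; first exact: fmap_proper_filter.
    move=> G GP VG; apply/seteqP; split=> // A GA.
    have [//|UnA] := in_ultra_setVsetC ((fun t => x t i 0) @^-1` A) UU.
    have GnA : G (~` A) by exact: VG.
    have : G (A `&` ~` A) by exact: filterI.
    by rewrite setICr => /filter_not_empty.
  have := @segment_compact R (- r) r; rewrite compact_ultra => /(_ V VU).
  case=> [|a [_ /= Va]]; last by exists a.
  by apply: filterS xr => t tr /=;
    rewrite in_itv /= -ler_norml (le_trans (coord_le _ _)).
have [a ha] := choice h.
by exists (\col_i a i); apply/cvg_coordP => i; rewrite mxE.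
Qed.

(** * Subgradients with a quadratic modulus of either sign *)

Section StrongSubgradients.
Context {R : realType} {n : nat}.
Implicit Types (f : 'cV[R]_n -> \bar R) (x u v w : 'cV[R]_n).

(** Jensen's inequality with modulus c, stated with real values on the domain so that linear
    arithmetic applies. Nonemptiness of the domain is carried separately by [eproper]. *)
Definition proper_convex (c : R) f : Prop :=
  (forall x, (-oo < f x)%E) /\
  forall x y (t : R), 0 < t < 1 -> edom f x -> edom f y ->
    edom f (t *: x + (1 - t) *: y) /\
    fine (f (t *: x + (1 - t) *: y)) <=
      t * fine (f x) + (1 - t) * fine (f y)
        - c / 2 * (t * (1 - t)) * dotp (x - y) (x - y).

Definition strong_subgrad (c : R) f x u : Prop :=
  edom f x /\ forall w, edom f w ->
    fine (f x) + dotp u (w - x) + c / 2 * dotp (w - x) (w - x) <= fine (f w).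

Lemma edom_fineK f x : (forall x, (-oo < f x)%E) -> edom f x -> f x = (fine (f x))%:E.
Proof. by move=> fp fx; rewrite fineK // fin_numElt fp. Qed.

Lemma edomP f x (r : R) : (forall x, (-oo < f x)%E) ->
  (f x <= r%:E)%E <-> edom f x /\ fine (f x) <= r.
Proof.
move=> fp; split=> [h|[d h]]; last by rewrite (edom_fineK fp d) lee_fin.
have d : edom f x by exact: le_lt_trans h (ltry _).
by split=> //; rewrite -lee_fin -(edom_fineK fp d).
Qed.

Lemma alpha_convex_proper (c : R) f :
  eproper f -> alpha_convex c f -> proper_convex c f.
Proof.
move=> [fp _] cf; split=> // x y t /[dup] t01 /andP[t0 t1] fx fy.
have := cf x y t t01; rewrite (edom_fineK fp fx) (edom_fineK fp fy) -!EFinB -!EFinM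
  -EFinD.
rewrite leeBlDr // -EFinD => /(edomP _ _ fp)[d h]; split=> //.
apply: le_trans h _; rewrite !enorm_sqr !dotpE [dotp y x]dotpC; lra.
Qed.

Lemma proper_convex_segment (c : R) f x w t : proper_convex c f -> 0 < t < 1 ->
  edom f x -> edom f w ->
  edom f (x + t *: (w - x)) /\
  fine (f (x + t *: (w - x))) <=
    fine (f x) + t * (fine (f w) - fine (f x))
      - c / 2 * (t * (1 - t)) * dotp (w - x) (w - x).
Proof.
move=> [_ cf] t01 fx fw.
have -> : x + t *: (w - x) = t *: w + (1 - t) *: x.
  by rewrite scalerBr scalerBl scale1r addrCA.
have [? h] := cf w x t t01 fw fx; split=> //; apply: le_trans h _; lra.
Qed.

(** By c-convexity the difference quotient on the segment from x to w is at most f(w) - f(x) - c/2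
    (1 - t) |w - x|^2. A lower bound on it at arbitrarily small t therefore gives the global
    inequality with the full modulus. *)
Lemma strong_subgrad_directional (c : R) f x u : proper_convex c f -> edom f x ->
  (forall w e, edom f w -> 0 < e -> exists2 t, 0 < t < 1 /\ t <= e &
     t * dotp u (w - x) - t * e <= fine (f (x + t *: (w - x))) - fine (f x)) ->
  strong_subgrad c f x u.
Proof.
move=> cf fx h; split=> // w fw; apply/ler_addgt0Pr => e e0.
set D := dotp (w - x) (w - x).
have D0 : 0 <= D by exact: dotp_ge0.
(* With t at most e / b, the slope error e / b and the curvature error |c|/2 t D add up to at most
   e. *)
pose b := 1 + `|c| / 2 * D.
have b0 : 0 < b by rewrite ltr_wpDr // mulr_ge0 // divr_ge0.
have eb0 : 0 < e / b by rewrite divr_gt0.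
have [t [t01 te] ht] := h w (e / b) fw eb0.
have [_] := proper_convex_segment cf t01 fx fw; rewrite -/D.
case/andP: t01 => t0 t1 h2.
have : t * (dotp u (w - x) - e / b) <=
    t * (fine (f w) - fine (f x) - c / 2 * (1 - t) * D) by lra.
rewrite ler_pM2l // => h3.
have -> : e = e / b * b by rewrite divfK // gt_eqF.
have cD : c / 2 * t * D <= `|c| / 2 * (e / b) * D.
  rewrite ler_wpM2r //; apply: (@le_trans _ _ (`|c| / 2 * t)).
    by rewrite ler_wpM2r ?(ltW t0) // ler_wpM2r // ler_norm.
  by rewrite ler_wpM2l // divr_ge0.
rewrite [X in _ <= _ + X]mulrDr mulr1; lra.
Qed.

(** A defect K |w - x|^2 is of second order along a segment and disappears in the directional limit;
    convexity then turns the local inequality into a global one. Note that r bounds the squared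
    distance. *)
Lemma strong_subgrad_local (c K r : R) f x u :
  proper_convex c f -> edom f x -> 0 < r ->
  (forall w, edom f w -> dotp (w - x) (w - x) <= r ->
     fine (f x) + dotp u (w - x) - K * dotp (w - x) (w - x) <= fine (f w)) ->
  strong_subgrad c f x u.
Proof.
move=> cf fx r0 h; apply: strong_subgrad_directional => // w e fw e0.
set D := dotp (w - x) (w - x).
have D0 : 0 <= D by exact: dotp_ge0.
(* The factor 1/2 makes s < 1 strict; the last two entries give s^2 D <= r and s |K| D <= e, with 1
   added to avoid a zero denominator. *)
pose s := 2^-1 * Num.min 1 (Num.min e (Num.min (r / (1 + D)) (e / (1 + `|K| * D)))).
have a1 : 0 < 1 + D by lra.
have a2 : 0 < 1 + `|K| * D by rewrite ltr_wpDr // mulr_ge0.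
have s0 : 0 < s by rewrite mulr_gt0 ?invr_gt0 // !lt_min ltr01 e0 !divr_gt0.
have sle : s <= Num.min 1 (Num.min e (Num.min (r / (1 + D)) (e / (1 + `|K| * D)))).
  rewrite ler_piMl ?invf_le1 ?ler1n //; move: s0; rewrite pmulr_rgt0 ?invr_gt0 //;
    exact: ltW.
move: sle; rewrite !le_min => /and4P[s1 se sr sK].
have s1' : s < 1.
  by rewrite /s; apply: (@le_lt_trans _ _ (2^-1 * 1));
    [rewrite ler_wpM2l ?invr_ge0 // ge_min lexx | lra].
exists s; first by rewrite s0 s1'.
have [d _] := proper_convex_segment cf (introT andP (conj s0 s1')) fx fw.
have := h _ d; rewrite [x + _]addrC addrK dotpZl !dotpZr -/D => hd.
move: sr sK; rewrite !ler_pdivlMr // => sr sK.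
have sD : s * (s * D) <= r.
  apply: le_trans sr; rewrite ler_pM2l //; nra.
have {hd} := hd sD; rewrite [_ *: _ + x]addrC.
have : s * (s * (K * D)) <= s * e.
  rewrite ler_pM2l //; apply: le_trans sK; rewrite ler_pM2l //.
  have KD : K * D <= `|K| * D by rewrite ler_wpM2r // ler_norm.
  lra.
lra.
Qed.

Lemma strong_subgrad_mono (c : R) f x u x' u' :
  strong_subgrad c f x u -> strong_subgrad c f x' u' ->
  c * dotp (x - x') (x - x') <= dotp (u - u') (x - x').
Proof.
move=> [fx h] [fx' h']; have := h _ fx'; have := h' _ fx.
rewrite !dotpE [dotp x x']dotpC; lra.
Qed.

(** Bounding the values by a convergent real family, instead of taking a liminf, makes finiteness at
    the limit part of the conclusion. *)
Lemma lsc_lim f (T : Type) (F : set_system T) (FF : ProperFilter F)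
    (x : T -> 'cV[R]_n) (l : 'cV[R]_n) (c : T -> R) (c0 : R) :
  (forall x, (-oo < f x)%E) -> lower_semicontinuous f ->
  x @ F --> l -> c @ F --> c0 ->
  (\forall t \near F, edom f (x t) /\ fine (f (x t)) <= c t) ->
  edom f l /\ fine (f l) <= c0.
Proof.
move=> fp fl xl cc h; apply/edomP => //; apply/lee_addgt0Pr => e e0.
rewrite leNgt -EFinD; apply/negP => /fl[V lV hV].
have h1 : \forall t \near F, V (x t) by exact: xl.
have h2 : \forall t \near F, c t < c0 + e.
  by apply: (cvgr_lt _ cc); rewrite ltrDl.
have [t [[xt1 xt2] [Vt ct]]] := filter_ex (filterI h (filterI h1 h2)).
have := hV _ Vt; rewrite (edom_fineK fp xt1) lte_fin => /lt_le_trans/(_ xt2).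
by move/lt_trans/(_ ct); rewrite ltxx.
Qed.

(** For fixed w the subgradient inequality bounds f(x_t) by a convergent quantity. Any single w in
    the domain already forces the limit point into the domain. *)
Lemma strong_subgrad_lim (c : R) f (T : Type) (F : set_system T) (FF : ProperFilter F)
    (x u : T -> 'cV[R]_n) (x0 u0 : 'cV[R]_n) :
  eproper f -> lower_semicontinuous f -> x @ F --> x0 -> u @ F --> u0 ->
  (\forall t \near F, strong_subgrad c f (x t) (u t)) -> strong_subgrad c f x0 u0.
Proof.
move=> [fp [w0 fw0]] fl xx uu h.
have key w : edom f w -> edom f x0 /\ fine (f x0) <=
    fine (f w) - (dotp u0 (w - x0) + c / 2 * dotp (w - x0) (w - x0)).
  move=> fw; apply: (lsc_lim FF fp fl xx (c := fun t =>
      fine (f w) - (dotp (u t) (w - x t) + c / 2 * dotp (w - x t) (w - x t)))).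
    have wx : w - x t @[t --> F] --> w - x0 by apply: cvgB => //; exact: cvg_cst.
    apply: cvgB; first exact: cvg_cst.
    apply: cvgD; first exact: cvg_dotp.
    by apply: cvgM; [exact: cvg_cst|exact: cvg_dotp].
  apply: filterS h => t [ft /(_ _ fw)]; split=> //; lra.
split=> [|w fw]; first by have [] := key _ fw0.
by have [_] := key _ fw; lra.
Qed.

Lemma lsc_ball_min f (q : 'cV[R]_n -> R) (x0 : 'cV[R]_n) (r : R) :
  eproper f -> lower_semicontinuous f -> continuous q -> edom f x0 ->
  exists2 w, edom f w /\ dotp (w - x0) (w - x0) <= r ^+ 2 &
    forall w', edom f w' -> dotp (w' - x0) (w' - x0) <= r ^+ 2 ->
      fine (f w) + q w <= fine (f w') + q w'.
Proof.
move=> [fp _] fl cq fx0.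
pose B w := edom f w /\ dotp (w - x0) (w - x0) <= r ^+ 2.
have Bx0 : B x0 by split=> //; rewrite subrr dotp0l sqr_ge0.
pose val w := fine (f w) + q w.
(* The limit l is chosen before c. Hence c may be [val l - 1], which excludes values tending to -oo,
   or inf + e for every e, which handles a minimizing sequence. *)
have cluster (w : nat -> 'cV[R]_n) : (forall j, B (w j)) ->
    exists l, forall c, (\forall j \near \oo, val (w j) <= c) -> B l /\ val l <= c.
  move=> Bw; have [U [UU ooU]] := @ultraFilterLemma _ (\oo : set_system nat) _.
  have [l wl] : exists l : 'cV[R]_n, w @ U --> l.
    apply: (@bounded_ultra_cvg _ _ _ UU _ _ (`|r| + enorm x0)); apply: nearW => j.
    have [_ h] := Bw j; rewrite -[w j](subrK x0); apply: le_trans (enormD _ _) _.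
    by rewrite lerD2r enorm_le // real_normK ?num_real.
  have lB : dotp (l - x0) (l - x0) <= r ^+ 2.
    have h : dotp (w j - x0) (w j - x0) @[j --> U] --> dotp (l - x0) (l - x0).
      by apply: cvg_dotp; apply: cvgB => //; exact: cvg_cst.
    by apply: (cvgr_to_le h); apply: nearW => j; have [] := Bw j.
  have key c : (\forall j \near \oo, val (w j) <= c) -> B l /\ val l <= c.
    move=> h; have [] : edom f l /\ fine (f l) <= c - q l; last first.
      by move=> fl1 fl2; split=> //; rewrite /val; lra.
    apply: (lsc_lim _ fp fl wl (c := fun j => c - q (w j))).
      by apply: cvgB; [exact: cvg_cst|apply: cvg_comp wl _; exact: cq].
    apply: filterS (ooU _ h) => j; rewrite /val => hj.
    by have [? _] := Bw j; split=> //; lra.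
  by exists l.
have min w : B w -> (forall w', B w' -> val w <= val w') ->
  exists2 w, edom f w /\ dotp (w - x0) (w - x0) <= r ^+ 2 &
    forall w', edom f w' -> dotp (w' - x0) (w' - x0) <= r ^+ 2 ->
      fine (f w) + q w <= fine (f w') + q w'.
  by move=> Bw h; exists w => // w' f' d'; exact: h.
have [[b bB]|nb] := pselect (exists b, forall w, B w -> b <= val w); last first.
  have /choice[w hw] : forall j : nat, exists w, B w /\ val w < - j%:R.
    move=> j; apply: contrapT => /forallNP h; apply: nb; exists (- j%:R) => w Bw.
    by rewrite leNgt; apply/negP => wj; exact: (h w).
  have [l hl] := cluster w (fun j => (hw j).1).
  suff [_] : B l /\ val l <= val l - 1 by lra.
  apply: hl; near=> j; apply: le_trans (ltW (hw j).2) _.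
  rewrite lerNl; near: j; exact: nbhs_infty_ger.
pose i := inf (val @` B).
have HI : has_inf (val @` B).
  by split; [exists (val x0); exists x0|exists b => _ [v Bv <-]; exact: bB].
have iB w : B w -> i <= val w by move=> Bw; apply: (ge_inf HI.2); exists w.
have /choice[w hw] : forall j : nat, exists w, B w /\ val w < i + j.+1%:R^-1.
  move=> j; have p : 0 < j.+1%:R^-1 :> R by rewrite invr_gt0.
  by have [_ [w Bw <-] h] := inf_adherent p HI; exists w.
have [l hl] := cluster w (fun j => (hw j).1).
have {}hl e : 0 < e -> B l /\ val l <= i + e.
  move=> e0; apply: hl; near=> j; apply: le_trans (ltW (hw j).2) _.
  rewrite lerD2l ltW //; near: j; exact: (near_infty_natSinv_lt (PosNum e0)).
apply: (min l) => [|w' Bw']; first exact: (hl _ ltr01).1.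
by apply: le_trans (iB _ Bw'); apply/ler_addgt0Pr => e /hl[].
Unshelve. all: by end_near. Qed.

End StrongSubgradients.

(** * Existence of Lagrange multipliers under a relative interior condition *)

Section Multipliers.
Context {R : realType}.

Lemma affine_set_scale n (V : set 'cV[R]_n) (t : R) x :
  affine_set V -> V 0 -> V x -> V (t *: x).
Proof. by move=> aV V0 Vx; have := aV x 0 t Vx V0; rewrite scaler0 addr0. Qed.

Lemma affine_set_add n (V : set 'cV[R]_n) x y :
  affine_set V -> V 0 -> V x -> V y -> V (x + y).
Proof.
move=> aV V0 Vx Vy; have := affine_set_scale 2 aV V0 (aV x y 2^-1 Vx Vy).
have -> : 1 - 2^-1 = 2^-1 :> R by lra.
by rewrite scalerDr !scalerA divff // !scale1r.
Qed.

(* Every linear subspace is the row space of a matrix, hence the kernel of one. *)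
Lemma affine_set_kernel n (V : set 'cV[R]_n) : affine_set V -> V 0 ->
  exists K : 'M[R]_n, forall x, V x <-> K *m x = 0.
Proof.
move=> aV V0.
(* [P k] says that V contains a row space of dimension k. One of maximal dimension is all of V,
   since a point of V outside it could be adjoined. *)
pose P k := `[< exists W : 'M[R]_n, \rank W = k /\
  forall x : 'cV_n, (x^T <= W)%MS -> V x >].
have P0 : exists k, P k.
  exists 0; apply/asboolP; exists 0; split=> [|x]; first by rewrite mxrank0.
  by rewrite submx0 -[0]trmx0 => /eqP/trmx_inj ->.
have Pn k : P k -> (k <= n)%N by move=> /asboolP[W [<- _]]; exact: rank_leq_row.
case: (ex_maxnP P0 Pn) => k /asboolP[W [<- WV]] kmax.
exists (cokermx W)^T => x.
have -> : (cokermx W)^T *m x = 0 <-> (x^T <= W)%MS.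
  rewrite submxE -[x in X in X <-> _]trmxK -trmx_mul.
  by split=> [|/eqP->]; [rewrite -[0]trmx0 => /trmx_inj ->|rewrite trmx0].
split; last exact: WV.
move=> Vx; apply: contrapT => /negP nx.
have /kmax : P (\rank (W + x^T)%MS).
  apply/asboolP; exists (W + x^T)%MS; split=> // u /sub_addsmxP[[a b] /= uE].
  have -> : u = (a *m W)^T + b 0 0 *: x.
    rewrite -[u]trmxK uE linearD /=; congr (_ + _).
    by rewrite trmx_mul trmxK [b]mx11_scalar tr_scalar_mx mul_mx_scalar !mxE.
  apply: affine_set_add => //; last exact: affine_set_scale.
  by apply: WV; rewrite trmxK submxMl.
apply/negP; rewrite -ltnNge; apply: rank_ltmx.
by rewrite ltmxE addsmxSl addsmx_sub submx_refl.
Qed.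

(* Penalization: the minimizers w_k of [h w + k/2 |A w|^2 + 1/2 |w - ws|^2] near
   ws converge to ws, and the multipliers [k A w_k] stay bounded because they
   lie in the linear span of the image of the domain, a relative neighbourhood
   of 0. *)
Lemma lagrange_multiplier m n (A : 'M[R]_(m, n)) (h : 'cV[R]_n -> \bar R) ws :
  eproper h -> lower_semicontinuous h -> proper_convex 0 h ->
  edom h ws -> A *m ws = 0 ->
  (forall w, edom h w -> A *m w = 0 -> fine (h ws) <= fine (h w)) ->
  relint [set A *m w | w in edom h] 0 ->
  exists y, forall w, edom h w -> fine (h ws) <= fine (h w) + dotp y (A *m w).
Proof.
move=> hp hl hc hws Aws hmin [C0 riC].
pose q k w := k%:R / 2 * dotp (A *m w) (A *m w) + 2^-1 * dotp (w - ws) (w - ws).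
have qc k : continuous (q k).
  have qF (F : set_system 'cV[R]_n) (FF : Filter F) (w : 'cV[R]_n) :
      v @[v --> F] --> w -> q k v @[v --> F] --> q k w.
    move=> vw; have Aw : A *m v @[v --> F] --> A *m w by exact: cvg_mulmx.
    have ww : v - ws @[v --> F] --> w - ws by apply: cvgB => //; exact: cvg_cst.
    by apply: cvgD; (apply: cvgM; [exact: cvg_cst|exact: cvg_dotp]).
  by move=> w; apply: (qF (nbhs w)); exact: cvg_id.
have /choice[w wP] : forall k, exists w, (edom h w /\ dotp (w - ws) (w - ws) <= 1) /\
    forall w', edom h w' -> dotp (w' - ws) (w' - ws) <= 1 ->
      fine (h w) + q k w <= fine (h w') + q k w'.
  move=> k; have [w] := lsc_ball_min 1 hp hl (qc k) hws.
  by rewrite !expr1n => w1 w2; exists w.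
have q0c : continuous (fun _ : 'cV[R]_n => 0 : R) by exact: cst_continuous.
have [wl [_ _] hL] := lsc_ball_min 1 hp hl q0c hws.
have {hL} [L hL] : exists L, forall k, L <= fine (h (w k)).
  exists (fine (h wl)) => k; have [[h1 h2] _] := wP k.
  by have := hL _ h1; rewrite expr1n !addr0; apply.
have hw k : fine (h (w k)) + k%:R / 2 * dotp (A *m w k) (A *m w k)
    + 2^-1 * dotp (w k - ws) (w k - ws) <= fine (h ws).
  have [_ /(_ ws hws)] := wP k.
  rewrite /q Aws subrr !dotp0l !mulr0 !addr0 addrA; apply; exact: ler01.
have [U [UU ooU]] := @ultraFilterLemma _ (\oo : set_system nat) _.
have [w0 ww0] : exists w0 : 'cV[R]_n, w @ U --> w0.
  apply: (@bounded_ultra_cvg _ _ _ UU _ _ (1 + enorm ws)); apply: nearW => k.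
  have [[_ h1] _] := wP k; rewrite -[w k](subrK ws); apply: le_trans (enormD _ _) _.
  by rewrite lerD2r enorm_le ?expr1n.
have wws : w k - ws @[k --> U] --> w0 - ws by apply: cvgB => //; exact: cvg_cst.
have Aw0 : A *m w0 = 0.
  apply: dotp_eq0; apply/eqP; rewrite eq_le dotp_ge0 andbT; apply/ler_addgt0Pr =>
    e e0.
  rewrite add0r; have AwU : A *m w k @[k --> U] --> A *m w0 by exact: cvg_mulmx.
  apply: (cvgr_to_le (cvg_dotp AwU AwU)); apply: ooU; near=> k.
  have k0 : 0 < k%:R :> R by rewrite ltr0n; near: k; exact: nbhs_infty_gt.
  have ke : 2 / e * (fine (h ws) - L) <= k%:R by near: k; exact: nbhs_infty_ger.
  have := hw k; have := hL k; have := dotp_ge0 (w k - ws) => d0 L0 hk.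
  have : k%:R * dotp (A *m w k) (A *m w k) <= 2 * (fine (h ws) - L) by lra.
  move: ke; rewrite mulrAC ler_pdivrMr // => ke h2.
  by rewrite -(ler_pM2l k0); lra.
have [hw0 w0le] : edom h w0 /\
    fine (h w0) <= fine (h ws) - 2^-1 * dotp (w0 - ws) (w0 - ws).
  apply: (lsc_lim _ hp.1 hl ww0 (c := fun k =>
    fine (h ws) - 2^-1 * dotp (w k - ws) (w k - ws))).
    apply: cvgB; [exact: cvg_cst|apply: cvgM; [exact: cvg_cst|exact: cvg_dotp]].
  apply: nearW => k; have [[h1 _] _] := wP k; split=> //.
  have := hw k; have : 0 <= k%:R / 2 * dotp (A *m w k) (A *m w k).
    by rewrite mulr_ge0 ?dotp_ge0.
  lra.
(* The limit w0 is feasible, so h(ws) <= h(w0), and the proximal term must vanish. *)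
have w0ws : w0 = ws.
  apply/eqP; rewrite -subr_eq0; apply/eqP/dotp_eq0/eqP; rewrite eq_le dotp_ge0 andbT.
  by have := hmin _ hw0 Aw0; lra.
rewrite {w0 hw0 w0le Aw0}w0ws in ww0 wws; rewrite subrr in wws.
pose y k : 'cV[R]_m := k%:R *: (A *m w k).
(* Once |w_k - ws|^2 < 1/4, every w_k + d with |d|^2 <= 1/4 stays in the unit ball, so the ball
   constraint is inactive. Expanding the penalty leaves a defect (k/2 CA^2 + 1/2) |d|^2, absorbed by
   [strong_subgrad_local]; the favourable term <y_k, A w_k> >= 0 is then dropped. *)
have opt : \forall k \near U, forall v, edom h v ->
    fine (h (w k)) <= fine (h v) + dotp (y k) (A *m v) + dotp (w k - ws) (v - w k).
  have : \forall k \near U, dotp (w k - ws) (w k - ws) < 4^-1.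
    by apply: (cvgr_lt _ (cvg_dotp wws wws)); rewrite dotp0l; lra.
  apply: filterS => k wk v hv; have [[hwk _] wkmin] := wP k.
  have lin (a b d : 'cV[R]_n) : dotp (- a - b) d = - dotp a d - dotp b d.
    by rewrite dotpDl !dotpNl.
  have [CA CA0 hCA] := mulmx_bounded A.
  have [_ /(_ _ hv)] : strong_subgrad 0 h (w k) (- (A^T *m y k) - (w k - ws)).
    apply: (@strong_subgrad_local _ _ _ (k%:R / 2 * CA ^+ 2 + 2^-1) 4^-1) => //.
    move=> x hx; set d := x - w k => dle.
    have -> : x = w k + d by rewrite /d addrC subrK.
    have xE : w k + d - ws = (w k - ws) + d by rewrite addrAC.
    have := wkmin (w k + d); rewrite /q xE mulmxDr.
    have -> : w k + d = x by rewrite /d addrC subrK.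
    have AdC : k%:R / 2 * dotp (A *m d) (A *m d) <= k%:R / 2 * (CA ^+ 2 * dotp d d).
      rewrite ler_wpM2l // -!enorm_sqr -exprMn ler_pXn2r ?nnegrE ?enorm_ge0 //.
      by rewrite mulr_ge0 ?enorm_ge0.
    have -> : dotp (- (A^T *m y k) - (w k - ws)) d =
        - (k%:R * dotp (A *m w k) (A *m d)) - dotp (w k - ws) d.
      by rewrite lin -dotp_mulmx dotpZl.
    move: wk AdC dle; set a := w k - ws; set p := A *m w k; set p' := A *m d.
    clearbody a d p p' => wk AdC dle /(_ hx).
    rewrite !dotpE [dotp d a]dotpC [dotp p' p]dotpC.
    have := dotp_ge0 (a - d); rewrite !dotpE [dotp d a]dotpC => ad /(_ _).
    have ad1 : dotp a a + dotp a d + (dotp a d + dotp d d) <= 1 by lra.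
    move=> /(_ ad1); lra.
  have yE : dotp (y k) (A *m (v - w k)) = dotp (y k) (A *m v) - dotp (y k) (A *m w k).
    by rewrite mulmxBr dotpDr dotpNr.
  rewrite lin -dotp_mulmx yE !mul0r addr0.
  have : 0 <= dotp (y k) (A *m w k) by rewrite dotpZl mulr_ge0 ?dotp_ge0.
  lra.
suff [r yr] : exists r, \forall k \near U, enorm (y k) <= r.
  have [ys yys] := bounded_ultra_cvg UU yr; exists ys => v hv.
  have [] // := @lsc_lim _ _ h _ U _ w ws
    (fun k => fine (h v) + dotp (y k) (A *m v) + dotp (w k - ws) (v - w k))
    (fine (h v) + dotp ys (A *m v)) hp.1 hl ww0.
    rewrite -[X in _ --> X]addr0 -(dotp0l (v - ws)); apply: cvgD; last first.
      by apply: cvg_dotp => //; apply: cvgB => //; exact: cvg_cst.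
    by apply: cvgD; [exact: cvg_cst|apply: cvg_dotp => //; exact: cvg_cst].
  by apply: filterS opt => k /(_ _ hv); have [[? _] _] := wP k.
apply: contrapT => /forallNP unb.
have {}unb r : \forall k \near U, r < enorm (y k).
  have [/unb//|] := in_ultra_setVsetC [set k | enorm (y k) <= r] UU.
  by apply: filterS => k /= /negP; rewrite -ltNge.
set C := [set A *m w | w in edom h] in C0 riC; pose V := aff_hull C.
have CV : C `<=` V by exact: sub_smallest.
have aV : affine_set V.
  by move=> a b t Va Vb S [aS CS]; apply: (aS);
    [exact: (Va S (conj aS CS))|exact: (Vb S (conj aS CS))].
have V0 : V 0 by exact: CV.
have [K KV] := affine_set_kernel aV V0.
pose e k := (enorm (y k))^-1 *: y k.
have Ve k : V (e k).
  apply: (affine_set_scale _ aV V0); apply: (affine_set_scale _ aV V0); apply: CV;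
    exists (w k) => //.
  by have [[]] := wP k.
have e1 : \forall k \near U, dotp (e k) (e k) = 1.
  apply: filterS (unb 0) => k y0.
  by rewrite dotpZl dotpZr -enorm_sqr; field; rewrite gt_eqF.
have [es ees] : exists es : 'cV[R]_m, e @ U --> es.
  apply: (@bounded_ultra_cvg _ _ _ UU _ _ 1); apply: filterS e1 => k ek.
  by rewrite enorm_le // ek expr1n.
(* V is closed because it is the kernel of K. *)
have Ves : V es.
  apply/KV; apply: dotp_eq0.
  have h1 : K *m e k @[k --> U] --> K *m es by exact: cvg_mulmx.
  have h2 : dotp (K *m e k) (K *m e k) @[k --> U] --> (0 : R).
    under eq_fun => k do rewrite (KV _).1 // dotp0l.
    exact: cvg_cst.
  exact: (cvg_unique _ (cvg_dotp h1 h1) h2).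
have es1 : dotp es es = 1.
  have h2 : dotp (e k) (e k) @[k --> U] --> (1 : R).
    exact: cvg_near_cst.
  exact: (cvg_unique _ (cvg_dotp ees ees) h2).
(* Relative interiority makes -t es the image of a point v of the domain. Then [opt] at v bounds t
   <y_k, es> = t |y_k| <e_k, es> from above. As |y_k| grows without bound, <e_k, es> is eventually
   at most 1/2, whereas it tends to |es|^2 = 1. *)
have [t t0 [v hv vE]] : exists2 t : R, 0 < t & C (- t *: es).
  have sc : s *: es @[s --> (0 : R)] --> (0 : 'cV[R]_m).
    rewrite -[X in _ --> X](scale0r es); apply: cvgZr_tmp; exact: cvg_id.
  have := sc _ riC; rewrite nbhs_simpl /= => /nbhs_ballP[r /= r0 hr].
  exists (r / 2); first by rewrite divr_gt0.
  apply: hr; last exact: (affine_set_scale _ aV V0).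
  by rewrite /ball /= sub0r opprK ger0_norm ?divr_ge0 ?ltW //; lra.
have bd : \forall k \near U, t * dotp (y k) es <= fine (h v) - L + 1.
  have : \forall k \near U, dotp (w k - ws) (v - w k) < 1.
    have wv : v - w k @[k --> U] --> v - ws by apply: cvgB => //; exact: cvg_cst.
    by apply: (cvgr_lt _ (cvg_dotp wws wv)); rewrite dotp0l.
  move: opt; apply: filterS2 => k /(_ _ hv); rewrite vE dotpZr; have := hL k; lra.
have small : t * dotp es es <= t / 2.
  have tc : t * dotp (e k) es @[k --> U] --> t * dotp es es.
    apply: cvgM; [exact: cvg_cst|apply: cvg_dotp => //; exact: cvg_cst].
  apply: (cvgr_to_le tc).
  pose b := Num.max 0 ((fine (h v) - L + 1) / (t / 2)).
  move: bd (unb b); apply: filterS2 => k bk.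
  rewrite gt_max => /andP[y0]; rewrite ltr_pdivrMr ?divr_gt0 // => h1.
  rewrite dotpZl mulrCA ler_pdivrMl //; lra.
by move: small; rewrite es1; lra.
Unshelve. all: by end_near. Qed.

End Multipliers.

(** * Convex and Fréchet subgradients, and minimizers of penalized functions *)

Section OptimalityConditions.
Context {R : realType}.

Lemma proper_convex_weaken n (c c' : R) (f : 'cV[R]_n -> \bar R) : c' <= c ->
  proper_convex c f -> proper_convex c' f.
Proof.
move=> cc [fp cf]; split=> // x y t t01 fx fy.
have [? h] := cf x y t t01 fx fy; split=> //; apply: le_trans h _.
case/andP: t01 => t0 t1; rewrite lerD2l lerN2 ler_wpM2r ?dotp_ge0 //.
by rewrite ler_wpM2r ?ler_pM2r ?invr_gt0 // mulr_ge0 ?subr_ge0 ?ltW.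
Qed.

Lemma subdiff_strong_subgrad n (c : R) (f : 'cV[R]_n -> \bar R) x u :
  proper_convex c f -> subdiff f x u -> strong_subgrad c f x u.
Proof.
move=> cf [fx h]; have fp := cf.1.
apply: (@strong_subgrad_local _ _ _ 0 1) => // w fw _.
have := h w; rewrite (edom_fineK fp fx) (edom_fineK fp fw) -EFinD lee_fin dotpC; lra.
Qed.

Lemma strong_subgrad_subdiff n (c : R) (f : 'cV[R]_n -> \bar R) x u : 0 <= c ->
  (forall w, (-oo < f w)%E) -> strong_subgrad c f x u -> subdiff f x u.
Proof.
move=> c0 fp [fx h]; split=> // w.
have [fw|] := pselect (edom f w); last first.
  by rewrite /edom /= ltey => /negP/negPn/eqP ->; rewrite leey.
rewrite (edom_fineK fp fx) (edom_fineK fp fw) -EFinD lee_fin dotpC.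
have : 0 <= c / 2 * dotp (w - x) (w - x) by rewrite mulr_ge0 ?dotp_ge0 // divr_ge0.
have := h w fw; lra.
Qed.

Lemma strong_subgrad_upgrade n (c c' : R) (f : 'cV[R]_n -> \bar R) x u :
  proper_convex c' f -> 0 <= c -> strong_subgrad c f x u -> strong_subgrad c' f x u.
Proof.
by move=> cf c0 /(strong_subgrad_subdiff c0 cf.1); apply: subdiff_strong_subgrad.
Qed.

(** The Fréchet condition is used only along the segment from z to w, where it supplies the small t
    required by [strong_subgrad_directional]. *)
Lemma frechet_strong_subgrad n (c : R) (g : 'cV[R]_n -> \bar R) z u :
  proper_convex c g -> frechet_subdiff g z u -> strong_subgrad c g z u.
Proof.
move=> cg [gz hl]; have gp := cg.1.
apply: strong_subgrad_directional => // w e gw e0.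
have [->|wz] := eqVneq w z.
  exists (Num.min 2^-1 e).
    by rewrite lt_min e0 gt_min ge_min lexx orbT invr_gt0 ltr0n invf_lt1 ?ltr1n.
  by rewrite subrr scaler0 addr0 subrr dotp0r mulr0 sub0r oppr_le0 mulr_ge0
    ?(ltW e0) // le_min (ltW e0) invr_ge0 ler0n.
have d0 : 0 < enorm (w - z) by rewrite enorm_gt0 // subr_eq0.
move: hl; rewrite limf_einfE => hl.
(* The liminf is compared with -e / |w - z|: at distance t |w - z| from z this becomes the error t
   e. *)
have ed0 : 0 < e / enorm (w - z) by rewrite divr_gt0.
have : (- (e / enorm (w - z))%:E < 0 :> \bar R)%E by rewrite -EFinN lte_fin oppr_lt0.
move=> /lt_le_trans/(_ hl)/ereal_sup_gt[_ [V Vz <-] hV].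
have [r r0 hr] : exists2 r : R, 0 < r &
    forall t, 0 < t -> t < r -> V (z + t *: (w - z)).
  have tz : z + t *: (w - z) @[t --> (0 : R)] --> z.
    rewrite -[X in _ --> X]addr0 -(scale0r (w - z)).
    by apply: cvgD; [exact: cvg_cst|apply: cvgZr_tmp; exact: cvg_id].
  have := tz _ Vz; rewrite nbhs_simpl /= => /nbhs_ballP[r /= r0 h].
  exists r => // t t0 tr; apply: h.
    by rewrite /ball /= sub0r normrN ger0_norm ?ltW.
  by rewrite addrC -subr_eq0 addrK scaler_eq0 (gt_eqF t0) subr_eq0.
pose t := 2^-1 * Num.min 1 (Num.min e r).
have m0 : 0 < Num.min 1 (Num.min e r) by rewrite !lt_min ltr01 e0.
have t0 : 0 < t by rewrite mulr_gt0 ?invr_gt0.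
have : t < Num.min 1 (Num.min e r) by rewrite /t; lra.
rewrite !lt_min => /and3P[t1 te tr].
exists t; first by rewrite t0 t1 (ltW te).
have [gt _] := proper_convex_segment cg (introT andP (conj t0 t1)) gz gw.
have : (- (e / enorm (w - z))%:E <= (g (z + t *: (w - z))%R - g z -
    (dotp u (z + t *: (w - z) - z)%R)%:E) *
    ((enorm (z + t *: (w - z) - z)%R)^-1)%:E)%E.
  apply: le_trans (ltW hV) _; apply: ereal_inf_lbound.
  by exists (z + t *: (w - z)) => //; exact: hr.
have -> : z + t *: (w - z) - z = t *: (w - z) by rewrite [X in X - _]addrC addrK.
rewrite (edom_fineK gp gz) (edom_fineK gp gt) dotpZr enormZ gtr0_norm //.
rewrite -!EFinB -EFinM -EFinN lee_fin ler_pdivlMr ?mulr_gt0 //.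
have -> : - (e / enorm (w - z)) * (t * enorm (w - z)) = - (t * e).
  by field; rewrite gt_eqF.
lra.
Qed.

(** The quotient is at least -|c|/2 |w - z|, which tends to 0 whatever the sign of c. *)
Lemma strong_subgrad_frechet n (c : R) (g : 'cV[R]_n -> \bar R) z u :
  (forall w, (-oo < g w)%E) -> strong_subgrad c g z u -> frechet_subdiff g z u.
Proof.
move=> gp [gz h]; split=> //; rewrite limf_einfE; apply/lee_subgt0Pr => e e0.
rewrite add0e.
pose V := [set w | w != z /\ `|c| / 2 * enorm (w - z) <= e].
apply: le_trans (ereal_sup_ubound _); last first.
  exists V; last by reflexivity.
  have hz : dotp (w - z) (w - z) @[w --> z] --> (0 : R).
    by apply/(@cvg_dotpP _ _ (nbhs z)); exact: cvg_id.
  pose b := e / (1 + `|c|).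
  have b0 : 0 < b by rewrite divr_gt0 // ltr_wpDr.
  have b2 : 0 < b ^+ 2 by rewrite exprn_gt0.
  have hb : \forall w \near z, dotp (w - z) (w - z) < b ^+ 2 by exact: (cvgr_lt _ hz).
  suff : \forall w \near z, w != z -> V w by [].
  apply: filterS hb => w wb wz; split=> //.
  have wb' : enorm (w - z) <= b by rewrite enorm_le ?(ltW b0) // ltW.
  apply: (@le_trans _ _ ((1 + `|c|) * b));
    last by rewrite mulrC divfK // gt_eqF // ltr_wpDr.
  apply: ler_pM => //; rewrite ?enorm_ge0 ?divr_ge0 //.
  by have := normr_ge0 c; lra.
apply: le_ereal_inf_tmp => _ [w [wz wV] <-].
have d0 : 0 < enorm (w - z) by rewrite enorm_gt0 // subr_eq0.
have [gw|] := pselect (edom g w); last first.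
  rewrite /edom /= ltey => /negP/negPn/eqP ->.
  by rewrite (edom_fineK gp gz) !addye // gt0_mulye ?leey // lte_fin invr_gt0.
rewrite (edom_fineK gp gz) (edom_fineK gp gw) -!EFinB -EFinM -EFinN lee_fin
  ler_pdivlMr //.
have := h _ gw; rewrite -!enorm_sqr.
have : - (`|c| / 2 * enorm (w - z)) * enorm (w - z) <= c / 2 * enorm (w - z) ^+ 2.
  have : 0 <= (c + `|c|) / 2 * enorm (w - z) ^+ 2.
    rewrite mulr_ge0 ?sqr_ge0 // divr_ge0 //.
    by have := ler_norm (- c); rewrite normrN; lra.
  lra.
have : - e * enorm (w - z) <= - (`|c| / 2 * enorm (w - z)) * enorm (w - z).
  by rewrite ler_wpM2r ?enorm_ge0 // lerN2.
lra.
Qed.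

(** The linear part of the expanded penalty is the subgradient, its quadratic part a defect for
    [strong_subgrad_local]. The general A and b serve both the x-step and the z-step. *)
Lemma penalized_min_strong_subgrad m n (c gamma : R) (h : 'cV[R]_n -> \bar R)
    (A : 'M[R]_(m, n)) y b w :
  proper_convex c h -> edom h w ->
  (forall w', edom h w' ->
     fine (h w) +
       (dotp y (A *m w - b) + gamma / 2 * dotp (A *m w - b) (A *m w - b)) <=
     fine (h w') +
       (dotp y (A *m w' - b) + gamma / 2 * dotp (A *m w' - b) (A *m w' - b))) ->
  strong_subgrad c h w (- (A^T *m (y + gamma *: (A *m w - b)))).
Proof.
move=> ch hw wmin; have [CA CA0 hCA] := mulmx_bounded A.
apply: (@strong_subgrad_local _ _ _ (`|gamma| / 2 * CA ^+ 2) 1) => // w' hw' _.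
have := wmin _ hw'; rewrite dotpNl -dotp_mulmx.
have -> : A *m w' - b = (A *m w - b) + A *m (w' - w).
  by rewrite mulmxBr [RHS]addrC addrA subrK.
have : gamma / 2 * dotp (A *m (w' - w)) (A *m (w' - w)) <=
    `|gamma| / 2 * CA ^+ 2 * dotp (w' - w) (w' - w).
  apply: (@le_trans _ _ (`|gamma| / 2 * dotp (A *m (w' - w)) (A *m (w' - w)))).
    by rewrite ler_wpM2r ?dotp_ge0 // ler_wpM2r // ler_norm.
  rewrite -[leRHS]mulrA ler_wpM2l ?divr_ge0 // -!enorm_sqr -exprMn.
  by rewrite ler_pXn2r ?nnegrE ?mulr_ge0 ?enorm_ge0.
move: (A *m (w' - w)) (A *m w - b) => p q.
rewrite !dotpE [dotp p q]dotpC; lra.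
Qed.

End OptimalityConditions.

(** * Sums and compositions of lower semicontinuous functions *)

Section LowerSemicontinuity.
Context {R : realType} {X : topologicalType}.

Lemma lower_semicontinuousD (f g : X -> \bar R) :
  (forall x, -oo < f x)%E -> (forall x, -oo < g x)%E ->
  lower_semicontinuous f -> lower_semicontinuous g ->
  lower_semicontinuous (fun x => f x + g x)%E.
Proof.
move=> fp gp fl gl x a afg.
have [b [c [bf cg abc]]] :
    exists b c, [/\ (b%:E < f x)%E, (c%:E < g x)%E & a <= b + c].
  move: afg (fp x) (gp x); case: (f x) => [r||]; case: (g x) => [s||] //.
  - rewrite -EFinD lte_fin => h _ _;
    exists (r - (r + s - a) / 2), (s - (r + s - a) / 2).
    by rewrite !lte_fin; split; lra.
  - move=> _ _ _; exists (r - 1), (a - (r - 1)).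
    by rewrite lte_fin ltry; split=> //; lra.
  - move=> _ _ _; exists (a - (s - 1)), (s - 1).
    by rewrite lte_fin ltry; split=> //; lra.
  - by move=> _ _ _; exists a, 0; rewrite !ltry addr0.
have [V xV hV] := fl x _ bf; have [W xW hW] := gl x _ cg.
exists (V `&` W); first exact: filterI.
move=> v [Vv Wv]; apply: (@le_lt_trans _ _ (b + c)%:E); first by rewrite lee_fin.
by rewrite EFinD; apply: lteD; [exact: hV|exact: hW].
Qed.

Lemma lower_semicontinuous_comp (Y : topologicalType) (f : X -> \bar R) (p : Y -> X) :
  continuous p -> lower_semicontinuous f -> lower_semicontinuous (fun y => f (p y)).
Proof.
move=> cp fl y a /fl[V pV hV]; exists (p @^-1` V); first exact: cp.
by move=> v; exact: hV.
Qed.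

Lemma continuous_lower_semicontinuous (q : X -> R) :
  continuous q -> lower_semicontinuous (fun x => (q x)%:E).
Proof.
move=> cq x a; rewrite lte_fin => ax; exists [set y | a < q y].
  exact: (cvgr_gt _ (cq x)).
by move=> y /=; rewrite lte_fin.
Qed.

End LowerSemicontinuity.

Lemma cvg_usubmx (R : realType) (T : Type) (F : set_system T) (FF : Filter F) m n
    (w : T -> 'cV[R]_(m + n)) (l : 'cV[R]_(m + n)) :
  w @ F --> l -> usubmx (w t) @[t --> F] --> usubmx l.
Proof.
move=> /cvg_coordP wl; apply/cvg_coordP => i; rewrite mxE.
by under eq_fun do rewrite mxE; exact: wl.
Qed.

Lemma cvg_dsubmx (R : realType) (T : Type) (F : set_system T) (FF : Filter F) m n
    (w : T -> 'cV[R]_(m + n)) (l : 'cV[R]_(m + n)) :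
  w @ F --> l -> dsubmx (w t) @[t --> F] --> dsubmx l.
Proof.
move=> /cvg_coordP wl; apply/cvg_coordP => i; rewrite mxE.
by under eq_fun do rewrite mxE; exact: wl.
Qed.

Lemma dotp_segment (R : realType) n (a b : 'cV[R]_n) t :
  dotp (t *: a + (1 - t) *: b) (t *: a + (1 - t) *: b) =
  t * dotp a a + (1 - t) * dotp b b - t * (1 - t) * dotp (a - b) (a - b).
Proof. by rewrite !dotpE [dotp b a]dotpC; ring. Qed.

(** * Optimality systems derived from the conditions (A) *)

Section KKT.
Context {R : realType} {m n : nat}.
Variables (M : 'M[R]_(m, n)) (f : 'cV[R]_n -> \bar R) (g : 'cV[R]_m -> \bar R).
Variables (alpha beta : R).
Hypotheses (fp : eproper f) (fc : proper_convex alpha f).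
Hypotheses (gp : eproper g) (gc : proper_convex beta g).

(** Critical points with z eliminated as M x and with the moduli alpha and beta built in, as the
    monotonicity estimates require. *)
Definition kkt x y : Prop :=
  strong_subgrad alpha f x (- (M^T *m y)) /\ strong_subgrad beta g (M *m x) y.

Lemma critical_point_kkt x z y : critical_point f g M x z y -> kkt x y.
Proof.
case=> sf sg /eqP; rewrite subr_eq0 => /eqP Mx; split;
  first exact: subdiff_strong_subgrad.
by rewrite Mx; exact: frechet_strong_subgrad.
Qed.

Lemma kkt_critical_point x y : 0 <= alpha -> kkt x y ->
  critical_point f g M x (M *m x) y.
Proof.
move=> a0 [sf sg]; split; last by rewrite subrr.
  exact: (strong_subgrad_subdiff a0 fp.1 sf).
exact: (strong_subgrad_frechet gp.1 sg).
Qed.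

(** The curvature of f pays for a negative curvature of g: for beta < 0 use |M d| <= |M| |d|. *)
Lemma strong_monotone_sum_ge0 d : 0 <= alpha -> 0 <= alpha + beta * opnorm M ^+ 2 ->
  0 <= alpha * dotp d d + beta * dotp (M *m d) (M *m d).
Proof.
move=> a0 ab0; have d0 := dotp_ge0 d; have Md0 := dotp_ge0 (M *m d).
have [b0|b0] := leP 0 beta; first by rewrite addr_ge0 // mulr_ge0.
have h : beta * (opnorm M ^+ 2 * dotp d d) <= beta * dotp (M *m d) (M *m d).
  by rewrite ler_nM2l // dotp_mulmx_le.
have : 0 <= (alpha + beta * opnorm M ^+ 2) * dotp d d by rewrite mulr_ge0.
lra.
Qed.

Lemma kkt_optimal x y : 0 <= alpha -> 0 <= alpha + beta * opnorm M ^+ 2 ->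
  kkt x y -> optimal_solution f g M x (M *m x).
Proof.
move=> a0 ab0 [[fx hf] [gx hg]]; split=> // x' _ <-.
have [fx'|] := pselect (edom f x'); last first.
  rewrite /edom /= ltey => /negP/negPn/eqP ->.
  by rewrite addye ?leey // gt_eqF // gp.1.
have [gx'|] := pselect (edom g (M *m x')); last first.
  rewrite /edom /= ltey => /negP/negPn/eqP ->.
  by rewrite addey ?leey // gt_eqF // fp.1.
rewrite (edom_fineK fp.1 fx) (edom_fineK fp.1 fx') (edom_fineK gp.1 gx)
  (edom_fineK gp.1 gx').
rewrite -!EFinD lee_fin.
have := strong_monotone_sum_ge0 (x' - x) a0 ab0.
have := hf _ fx'; have := hg _ gx'; rewrite dotpNl -dotp_mulmx mulmxBr; lra.
Qed.

Lemma lagrangianE x z y : edom f x -> edom g z ->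
  lagrangian f g M x z y = (fine (f x) + fine (g z) + dotp y (M *m x - z))%:E.
Proof.
move=> fx gz; rewrite /lagrangian /aug_lagrangian (edom_fineK fp.1 fx)
  (edom_fineK gp.1 gz).
by rewrite !mul0r addr0 -!EFinD.
Qed.

Lemma saddle_point_kkt x z y : saddle_point f g M x z y -> kkt x y.
Proof.
move=> sp; have [x0 fx0] := fp.2; have [z0 gz0] := gp.2.
have [fx gz] : edom f x /\ edom g z.
  have [_] := sp x0 z0 y; rewrite (lagrangianE _ fx0 gz0) /lagrangian /aug_lagrangian.
  move=> h; have {h} := le_lt_trans h (ltry _); rewrite /edom /=.
  by move: (fp.1 x) (gp.1 z); case: (f x) => [r||]; case: (g z) => [s||] //;
    rewrite !ltry.
(* Testing the multiplier y + (M x - z) raises the Lagrangian by |M x - z|^2. *)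
have rz : M *m x - z = 0.
  have [] := sp x z (y + (M *m x - z)); rewrite !lagrangianE // lee_fin dotpDl => h _.
  by apply: dotp_eq0; apply/eqP; rewrite eq_le dotp_ge0 andbT; lra.
have zE : z = M *m x by apply/esym/eqP; rewrite -subr_eq0 rz.
have {}sp x' z' : edom f x' -> edom g z' ->
    fine (f x) + fine (g z) <= fine (f x') + fine (g z') + dotp y (M *m x' - z').
  move=> fx' gz'; have [_] := sp x' z' y.
  by rewrite !lagrangianE // rz dotp0r addr0 lee_fin.
split.
  apply: (@strong_subgrad_local _ _ _ 0 1) => // x' fx' _.
  have := sp x' z fx' gz; rewrite zE dotpNl -dotp_mulmx mulmxBr; lra.
rewrite -zE; apply: (@strong_subgrad_local _ _ _ 0 1) => // z' gz' _.
have := sp x z' fx gz'; rewrite -zE !dotpDr !dotpNr; lra.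
Qed.

(** The problem is put on pairs (u, v) with the single linear constraint v - M u = 0. The image of
    the domain under this map is dom g - M (dom f), so the qualification is the one that
    [lagrange_multiplier] asks for. *)
Lemma qualified_optimal_kkt x z :
  lower_semicontinuous f -> lower_semicontinuous g ->
  0 <= alpha -> 0 <= alpha + beta * opnorm M ^+ 2 ->
  optimal_solution f g M x z ->
  relint (set_sub (edom g) [set M *m x | x in edom f]) 0 ->
  exists y, kkt x y.
Proof.
move=> fl gl a0 ab0 [zE opt] ri.
have [fx gx] : edom f x /\ edom g (M *m x).
  have [[z0 gz0 [_ [x0 fx0 <-] xz0]] _] := ri.
  have : (f x + g z < +oo)%E.
    apply: le_lt_trans (opt x0 z0 _) _; first by apply/eqP;
      rewrite eq_sym -subr_eq0 xz0.
    by rewrite lte_add_pinfty.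
  rewrite zE /edom /=.
  by move: (fp.1 x) (gp.1 z); case: (f x) => [r||]; case: (g z) => [s||] //;
    rewrite !ltry.
have {zE} opt x' : edom f x' -> edom g (M *m x') ->
    fine (f x) + fine (g (M *m x)) <= fine (f x') + fine (g (M *m x')).
  move=> fx' gx'; have := opt x' _ erefl.
  rewrite -zE (edom_fineK fp.1 fx) (edom_fineK fp.1 fx') (edom_fineK gp.1 gx)
    (edom_fineK gp.1 gx').
  by rewrite -!EFinD lee_fin.
pose q (w : 'cV[R]_(n + m)) := - (alpha / 2 * dotp (usubmx w - x) (usubmx w - x)
   + beta / 2 * dotp (dsubmx w - M *m x) (dsubmx w - M *m x)).
(* Subtracting the quadratics centred at the solution makes both parts convex
   and preserves the optimality of the solution. *)
pose h w := (f (usubmx w) + g (dsubmx w) + (q w)%:E)%E.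
have hE w : edom f (usubmx w) -> edom g (dsubmx w) ->
    h w = (fine (f (usubmx w)) + fine (g (dsubmx w)) + q w)%:E.
  by move=> fw gw; rewrite /h (edom_fineK fp.1 fw) (edom_fineK gp.1 gw) -!EFinD.
have hdom w : edom h w <-> edom f (usubmx w) /\ edom g (dsubmx w).
  split=> [|[fw gw]]; last by rewrite /edom /= hE // ltry.
  rewrite /edom /= /h.
  by move: (fp.1 (usubmx w)) (gp.1 (dsubmx w)); case: (f _) => [r||]; case: (g _) =>
    [s||] //; rewrite !ltry.
have fineh w : edom h w -> fine (h w) =
  fine (f (usubmx w)) + fine (g (dsubmx w)) + q w.
  by move=> /hdom[fw gw]; rewrite hE.
have hp : forall w, (-oo < h w)%E.
  move=> w; rewrite /h.
  by move: (fp.1 (usubmx w)) (gp.1 (dsubmx w)); case: (f _) => [r||]; case: (g _) =>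
    [s||] //; rewrite !ltNyr.
pose ws := col_mx x (M *m x).
have hws : edom h ws by apply/hdom; rewrite col_mxKu col_mxKd.
have qws : q ws = 0 by rewrite /q col_mxKu col_mxKd !subrr !dotp0l !mulr0 addr0 oppr0.
pose A := row_mx (- M) 1%:M.
have AE (w : 'cV[R]_(n + m)) : A *m w = dsubmx w - M *m usubmx w.
  by rewrite -[in LHS](vsubmxK w) mul_row_col mul1mx mulNmx addrC.
have [y hy] : exists y, forall w, edom h w -> fine (h ws) <=
  fine (h w) + dotp y (A *m w).
  apply: lagrange_multiplier => //.
  - by split=> //; exists ws.
  - have qc : continuous q.
      have qF (F : set_system 'cV[R]_(n + m)) (FF : Filter F) (w : 'cV[R]_(n + m)) :
          v @[v --> F] --> w -> q v @[v --> F] --> q w.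
        move=> vw.
        have uw : usubmx v - x @[v --> F] --> usubmx w - x.
          by apply: cvgB; [exact: cvg_usubmx|exact: cvg_cst].
        have dw : dsubmx v - M *m x @[v --> F] --> dsubmx w - M *m x.
          by apply: cvgB; [exact: cvg_dsubmx|exact: cvg_cst].
        by apply: cvgN; apply: cvgD; (apply: cvgM; [exact: cvg_cst|exact: cvg_dotp]).
      by move=> w; apply: (qF (nbhs w)); exact: cvg_id.
    have uc : continuous (fun w : 'cV[R]_(n + m) => usubmx w).
      by move=> w; apply: (cvg_usubmx (F := nbhs w)); exact: cvg_id.
    have dc : continuous (fun w : 'cV[R]_(n + m) => dsubmx w).
      by move=> w; apply: (cvg_dsubmx (F := nbhs w)); exact: cvg_id.
    apply: lower_semicontinuousD; last exact: continuous_lower_semicontinuous.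
    + move=> w; move: (fp.1 (usubmx w)) (gp.1 (dsubmx w)).
      by case: (f _) => [r||]; case: (g _) => [s||] //; rewrite !ltNyr.
    + by move=> w; rewrite ltNyr.
    by apply: lower_semicontinuousD; [move=> w; exact: fp.1|move=> w; exact: gp.1
      |exact: lower_semicontinuous_comp|exact: lower_semicontinuous_comp].
  - split=> // w1 w2 t t01 h1 h2.
    have [/hdom[f1 g1] /hdom[f2 g2]] := (h1, h2).
    have [f3 cf] := fc.2 _ _ t t01 f1 f2; have [g3 cg] := gc.2 _ _ t t01 g1 g2.
    have uE : usubmx (t *: w1 + (1 - t) *: w2) =
      t *: usubmx w1 + (1 - t) *: usubmx w2.
      by apply/matrixP => i j; rewrite !mxE.
    have dE : dsubmx (t *: w1 + (1 - t) *: w2) =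
      t *: dsubmx w1 + (1 - t) *: dsubmx w2.
      by apply/matrixP => i j; rewrite !mxE.
    have h3 : edom h (t *: w1 + (1 - t) *: w2) by apply/hdom; rewrite uE dE.
    split=> //; rewrite !fineh // /q uE dE.
    have seg k (a b c : 'cV[R]_k) : t *: a + (1 - t) *: b - c =
      t *: (a - c) + (1 - t) *: (b - c).
      by rewrite !scalerBr addrACA -opprD -scalerDl addrCA subrr addr0 scale1r.
    rewrite (seg _ (usubmx w1)) (seg _ (dsubmx w1)) !dotp_segment.
    have ->: usubmx w1 - x - (usubmx w2 - x) = usubmx w1 - usubmx w2.
      by rewrite opprB addrA subrK.
    have ->: dsubmx w1 - M *m x - (dsubmx w2 - M *m x) = dsubmx w1 - dsubmx w2.
      by rewrite opprB addrA subrK.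
    lra.
  - by rewrite AE col_mxKu col_mxKd subrr.
  - move=> w /[dup] hw /hdom[fw gw]; rewrite AE => /eqP; rewrite subr_eq0 => /eqP dE.
    rewrite !fineh // qws addr0 /ws col_mxKu col_mxKd /q.
    rewrite dE in gw *; rewrite -mulmxBr.
    set d := usubmx w - x; set D := _ + fine (g _) + _.
    pose Q := alpha * dotp d d + beta * dotp (M *m d) (M *m d).
    have Q0 : 0 <= Q by exact: strong_monotone_sum_ge0.
    rewrite leNgt; apply/negP => Dlt.
    set E := fine (f (usubmx w)) + fine (g (M *m usubmx w))
      - (fine (f x) + fine (g (M *m x))).
    have E0 : 0 <= E by rewrite subr_ge0; exact: opt.
    have EQ : E < Q / 2 by rewrite /E /Q; move: Dlt; rewrite /D; lra.
    (* Optimality against the intermediate point gives (1 - t) Q/2 <= E. For this t the left side is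
       the midpoint of E and Q/2, which exceeds E. *)
    pose t := (Q / 2 - E) / Q.
    have Qp : 0 < Q by lra.
    have tQ : t * Q = Q / 2 - E by rewrite /t divfK // gt_eqF.
    have t01 : 0 < t < 1 by rewrite divr_gt0 ?subr_gt0 //= ltr_pdivrMr //; lra.
    have [f3 cf] := proper_convex_segment fc t01 fx fw.
    have [g3 cg] := proper_convex_segment gc t01 gx gw.
    have ME : M *m x + t *: (M *m usubmx w - M *m x) = M *m (x + t *: (usubmx w - x)).
      by rewrite mulmxDr -scalemxAr mulmxBr.
    rewrite ME in g3 cg; have := opt _ f3 g3.
    move: cf cg; rewrite -mulmxBr -/d => cf cg o.
    have : t * ((1 - t) * Q / 2) <= t * E by rewrite /E /Q; lra.
    case/andP: t01 => t0 t1; rewrite ler_pM2l //; lra.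
  - suff -> : [set A *m w | w in edom h] =
    set_sub (edom g) [set M *m x | x in edom f] by [].
    apply/seteqP; split=> [_ [w /hdom[fw gw] <-]|_ [v gv [_ [u fu <-] <-]]].
      by rewrite AE; exists (dsubmx w) => //; exists (M *m usubmx w) => //;
        exists (usubmx w).
    exists (col_mx u v); last by rewrite AE col_mxKu col_mxKd.
    by apply/hdom; rewrite col_mxKu col_mxKd.
have fws : fine (h ws) = fine (f x) + fine (g (M *m x)).
  by rewrite (fineh _ hws) qws addr0 col_mxKu col_mxKd.
(* Freezing one block of the pair separates the two inclusions; the subtracted quadratic comes back
   as the modulus. *)
exists (- y); split; split=> //.
  move=> u fu; have hu : edom h (col_mx u (M *m x)) by apply/hdom;
    rewrite col_mxKu col_mxKd.
  have := hy _ hu; rewrite fws (fineh _ hu) /q AE col_mxKu col_mxKd subrr dotp0l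
    mulr0 addr0.
  have -> : dotp y (M *m x - M *m u) = - dotp y (M *m (u - x)).
    by rewrite mulmxBr -dotpNr opprB.
  rewrite mulmxN opprK -dotp_mulmx; lra.
move=> v gv; have hv : edom h (col_mx x v) by apply/hdom; rewrite col_mxKu col_mxKd.
have := hy _ hv; rewrite fws (fineh _ hv) /q AE col_mxKu col_mxKd subrr dotp0l mulr0
  add0r.
rewrite dotpNl; lra.
Qed.

End KKT.

(** * Directions along which f never increases *)

Section RecessionDirections.
Context {R : realType} {n : nat}.
Variable (f : 'cV[R]_n -> \bar R).
Hypotheses (fp : eproper f) (fl : lower_semicontinuous f) (fc : proper_convex 0 f).

(** This is rec f <= 0 written without differences of infinite values. Such directions are closed
    under sums, so natural multiples can replace rays. *)
Definition recession_direction (d : 'cV[R]_n) : Prop :=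
  forall w, (f (w + d)%R <= f w)%E.

Lemma recession_direction0 : recession_direction 0.
Proof. by move=> w; rewrite addr0. Qed.

Lemma recession_directionD d d' :
  recession_direction d -> recession_direction d' -> recession_direction (d + d').
Proof. by move=> h h' w; rewrite addrA; apply: le_trans (h' _) (h _). Qed.

Lemma recession_directionMn d k : recession_direction d ->
  recession_direction (k%:R *: d).
Proof.
move=> h; elim: k => [|k IH]; first by rewrite scale0r; exact: recession_direction0.
by rewrite mulrS scalerDl scale1r; exact: recession_directionD.
Qed.

Lemma recession_direction_dom d w : recession_direction d -> edom f w ->
  edom f (w + d) /\ fine (f (w + d)) <= fine (f w).
Proof.
move=> h fw; have fwd : edom f (w + d) by exact: le_lt_trans (h w) fw.
by split=> //; have := h w;
  rewrite (edom_fineK fp.1 fw) (edom_fineK fp.1 fwd) lee_fin.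
Qed.

Lemma recession_directionP d : recession_direction d <->
  forall w, edom f w -> edom f (w + d) /\ fine (f (w + d)) <= fine (f w).
Proof.
split=> [h w|h w]; first exact: recession_direction_dom.
have [fw|] := pselect (edom f w); last first.
  by rewrite /edom /= ltey => /negP/negPn/eqP ->; rewrite leey.
have [fwd le] := h w fw.
by rewrite (edom_fineK fp.1 fw) (edom_fineK fp.1 fwd) lee_fin.
Qed.

Lemma recession_le0 d : (recession f d <= 0)%E <-> recession_direction d.
Proof.
split=> [h|h].
  apply/recession_directionP => w fw.
  have := ereal_sup_ubound (imageP (fun x => f (x + d)%R - f x)%E
    fw : [set _ | _ in _] _).
  move=> /le_trans/(_ h); rewrite (edom_fineK fp.1 fw) leeBlDr // add0e.
  by move/(edomP _ _ fp.1).
apply: ge_ereal_sup => _ [w fw <-]; have [fwd le] := recession_direction_dom h fw.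
by rewrite (edom_fineK fp.1 fw) (edom_fineK fp.1 fwd) -EFinB lee_fin subr_le0.
Qed.

Lemma recession_direction_dotp_le0 d x v :
  recession_direction d -> strong_subgrad 0 f x v -> dotp v d <= 0.
Proof.
move=> h [fx hv]; have [fxd le] := recession_direction_dom h fx.
have := hv _ fxd; rewrite [x + d]addrC addrK addrC !mul0r addr0 addrC.
by move: le; rewrite [x + d]addrC; lra.
Qed.

(* The points [prox_{t f}(x + d)] converge to x + d as t -> 0, and their proximal
   residuals are subgradients of f, hence orthogonal to d, so that f is at most
   f x at these points. *)
Lemma orthogonal_recession_direction d x0 v0 : strong_subgrad 0 f x0 v0 ->
  (forall x v, strong_subgrad 0 f x v -> dotp v d = 0) -> recession_direction d.
Proof.
move=> [fx0 hv0] orth; apply/recession_directionP => x fx.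
set p := x + d.
(* The proximal point w will satisfy |w - p| < |d| + 1, hence |w - x| < r: it is interior to the
   ball, and its minimality there yields a subgradient. *)
pose r := 2 * enorm d + 1.
have r0 : 0 < r by rewrite ltr_wpDl // mulr_ge0 // enorm_ge0.
have [c hc] : exists c, forall w, edom f w -> dotp (w - x) (w - x) <= r ^+ 2 ->
  c <= fine (f w).
  have q0c : continuous (fun _ : 'cV[R]_n => 0 : R) by exact: cst_continuous.
  have [w _ h] := lsc_ball_min r fp fl q0c fx.
  by exists (fine (f w)) => w' fw' w'r; have := h _ fw' w'r; rewrite !addr0.
pose b := fine (f x) - c.
have b0 : 0 <= b by rewrite subr_ge0; apply: hc; rewrite // subrr dotp0l sqr_ge0.
have key t : 0 < t -> t * b < 2^-1 ->
    exists2 w, edom f w /\ fine (f w) <= fine (f x) & dotp (w - p) (w - p) <= t * b.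
  move=> t0 tb; pose q w := t^-1 / 2 * dotp (w - p) (w - p).
  have qc : continuous q.
    have qF (F : set_system 'cV[R]_n) (FF : Filter F) (w : 'cV[R]_n) :
        v @[v --> F] --> w -> q v @[v --> F] --> q w.
      move=> vw; have wp : v - p @[v --> F] --> w - p by apply: cvgB => //;
        exact: cvg_cst.
      by apply: cvgM; [exact: cvg_cst|exact: cvg_dotp].
    by move=> w; apply: (qF (nbhs w)); exact: cvg_id.
  have [w [fw wr] wmin] := lsc_ball_min r fp fl qc fx.
  have tt : t^-1 * t = 1 by rewrite mulVf // gt_eqF.
  have wx : fine (f w) + q w <= fine (f x) + q x.
    by apply: wmin; rewrite // subrr dotp0l sqr_ge0.
  have xp : x - p = - d by rewrite /p opprD addrA subrr add0r.
  have wpd : dotp (w - p) (w - p) <= 2 * t * b + dotp d d.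
    have cw := hc _ fw wr.
    have : t * q w <= t * (b + q x) by rewrite ler_pM2l //; rewrite /b; lra.
    have qE u : t * q u = 2^-1 * dotp (u - p) (u - p) by rewrite /q !mulrA
      [t * t^-1]mulrC tt mul1r.
    by rewrite mulrDr !qE xp dotpNl dotpNr opprK; lra.
  have wp1 : enorm (w - p) < enorm d + 1.
    rewrite -(ltr_pXn2r (ltn0Sn 1)) ?nnegrE ?addr_ge0 ?enorm_ge0 //.
    rewrite enorm_sqr; apply: (le_lt_trans wpd); rewrite sqrrD enorm_sqr.
    have := enorm_ge0 d; lra.
  have wxr : enorm (w - x) < r.
    have -> : w - x = (w - p) + d by rewrite /p opprD addrA subrK.
    apply: (le_lt_trans (enormD _ _)); rewrite /r; lra.
  have sg : strong_subgrad 0 f w (t^-1 *: (p - w)).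
    have rho : 0 < r - enorm (w - x) by rewrite subr_gt0.
    apply: (@strong_subgrad_local _ _ _ (t^-1 / 2) ((r - enorm (w - x)) ^+ 2)) => //.
      by rewrite exprn_gt0.
    move=> w' fw'; rewrite -enorm_le ?(ltW rho) // => ww.
    have w'r : dotp (w' - x) (w' - x) <= r ^+ 2.
      rewrite -enorm_le ?(ltW r0) //.
      have -> : w' - x = (w' - w) + (w - x) by rewrite addrA subrK.
      apply: (le_trans (enormD _ _)); lra.
    have := wmin _ fw' w'r; rewrite /q.
    have -> : w' - p = (w' - w) - (p - w) by rewrite opprB addrA subrK.
    rewrite -(opprB p w); move: (w' - w) (p - w) => a e.
    rewrite dotpZl !dotpE [dotp e a]dotpC; lra.
  (* The subgradient (p - w) / t is tested at x, where x - w = (p - w) - d. Orthogonality to d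
     leaves f(w) + |p - w|^2 / t <= f(x), which gives both claims. *)
  have := sg.2 _ fx; rewrite mul0r mul0r addr0.
  have -> : x - w = (p - w) - d by rewrite /p addrAC addrK.
  rewrite dotpDr dotpNr (orth _ _ sg) subr0 dotpZl -(opprB w p) dotpNl dotpNr
    opprK => h.
  have e0 := dotp_ge0 (w - p); have cw := hc _ fw wr.
  have h2 : t * (t^-1 * dotp (w - p) (w - p)) <= t * (fine (f x) - fine (f w)).
    by rewrite ler_pM2l //; lra.
  rewrite mulrA [t * _]mulrC tt mul1r in h2.
  have e1 : 0 <= t * (fine (f x) - fine (f w)) by exact: le_trans h2.
  rewrite pmulr_rge0 // in e1.
  exists w; first by split=> //; rewrite -subr_ge0.
  by apply: (le_trans h2); rewrite ler_pM2l // /b lerD2l lerN2.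
have b1 : 0 < 2 * (b + 1) by lra.
(* The denominator uses b + 1 because b may be 0. *)
pose t k : R := k.+1%:R^-1 / (2 * (b + 1)).
have t0 k : 0 < t k by rewrite divr_gt0 // invr_gt0.
have tE k : t k * (2 * (b + 1)) = k.+1%:R^-1 by rewrite /t divfK ?gt_eqF.
have tb k : t k * b <= k.+1%:R^-1 / 2 by rewrite -tE; have := t0 k; lra.
have tb' k : t k * b < 2^-1.
  have : k.+1%:R^-1 <= 1 :> R by rewrite invf_le1 ?ler1n.
  by rewrite -tE; have := t0 k; lra.
have /choice[w hw] : forall k, exists w, (edom f w /\ fine (f w) <= fine (f x)) /\
    dotp (w - p) (w - p) <= t k * b.
  by move=> k; have [w h1 h2] := key _ (t0 k) (tb' k); exists w.
have wp : w @ \oo --> p.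
  apply/cvg_dotpP; apply/cvgr0Pnorm_lt => e e0; near=> k.
  rewrite ger0_norm ?dotp_ge0 //; apply: (le_lt_trans (hw k).2).
  apply: (le_lt_trans (tb k)); rewrite ltr_pdivrMr //.
  have : k.+1%:R^-1 < e by near: k; exact: (near_infty_natSinv_lt (PosNum e0)).
  by move/lt_trans; apply; rewrite ltr_pMr // ltr1n.
apply: (lsc_lim _ fp.1 fl wp (cvg_cst (fine (f x)))).
by apply: nearW => k; exact: (hw k).1.
Unshelve. all: by end_near. Qed.

Lemma coercive_recession_direction d : coercive f -> recession_direction d -> d = 0.
Proof.
move=> cf h; apply/eqP; apply: contrapT => /negP d0.
have [w fw] := fp.2; have [r hr] := cf (fine (f w)).
have [k hk] : exists k : nat, (r + enorm w) / enorm d < k%:R.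
  by exists (Num.trunc ((r + enorm w) / enorm d)).+1; exact: truncnS_gt.
have [fk lek] := recession_direction_dom (recession_directionMn k h) fw.
have : r < enorm (w + k%:R *: d).
  move: hk; rewrite ltr_pdivrMr ?enorm_gt0 // => hk.
  have := enormD (w + k%:R *: d) (- w); rewrite [w + _]addrC addrK enormZ enormN.
  by rewrite ger0_norm //; lra.
by move=> /hr; rewrite (edom_fineK fp.1 fk) lte_fin ltNge lek.
Qed.

Lemma strongly_convex_recession_direction c d x v : 0 < c -> strong_subgrad c f x v ->
  recession_direction d -> d = 0.
Proof.
move=> c0 [fx hv] h; apply/eqP; apply: contrapT => /negP d0.
have dd : 0 < c * dotp d d by rewrite mulr_gt0 ?dotp_gt0.
pose a := - dotp v d * 2 / (c * dotp d d).
have [k hk] : exists k : nat, Num.max 0 a < k%:R.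
  by exists (Num.trunc (Num.max 0 a)).+1; exact: truncnS_gt.
have [fk lek] := recession_direction_dom (recession_directionMn k h) fx.
have := hv _ fk; rewrite [x + _]addrC addrK !dotpZr dotpZl [_ + x]addrC => hv'.
move: hk; rewrite gt_max ltr_pdivrMr // => /andP[k0 hk].
have : k%:R * (dotp v d + c / 2 * (k%:R * dotp d d)) <= 0 by lra.
by rewrite pmulr_rle0 //; lra.
Qed.

(** A linear functional that attains its maximum over C at a relative interior point is constant on
    C: the segment from v to v0 can be prolonged slightly beyond v0 inside C. *)
Lemma relint_dotp_eq0 (C : set 'cV[R]_n) v0 d v : relint C v0 -> dotp v0 d = 0 ->
  (forall v, C v -> dotp v d <= 0) -> C v -> dotp v d = 0.
Proof.
move=> [Cv0 riC] v0d Cd Cv; apply/eqP; rewrite eq_le Cd //=.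
have sc : v0 + s *: (v0 - v) @[s --> (0 : R)] --> v0.
  rewrite -[X in _ --> X]addr0 -(scale0r (v0 - v)).
  by apply: cvgD; [exact: cvg_cst|apply: cvgZr_tmp; exact: cvg_id].
have := sc _ riC; rewrite nbhs_simpl /= => /nbhs_ballP[r /= r0 hr].
have r2 : 0 < r / 2 by rewrite divr_gt0.
have /Cd : C (v0 + (r / 2) *: (v0 - v)).
  apply: hr; first by rewrite /ball /= sub0r normrN ger0_norm ?divr_ge0 ?ltW //; lra.
  move=> S [aS CS].
  have -> : v0 + (r / 2) *: (v0 - v) = (1 + r / 2) *: v0 + (1 - (1 + r / 2)) *: v.
    by rewrite opprD addrA subrr add0r scalerBr scalerDl scale1r scaleNr addrA.
  by apply: aS; exact: CS.
rewrite dotpDl dotpZl dotpDl dotpNl v0d !add0r mulrN.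
by rewrite oppr_le0 pmulr_rge0.
Qed.

End RecessionDirections.

(** * Consequences of the conditions (B), and limits of subgradients with unbounded base points *)

Section AttainedLimits.
Context {R : realType} {m n : nat}.
Variables (M : 'M[R]_(m, n)) (f : 'cV[R]_n -> \bar R).
Hypotheses (fp : eproper f) (fl : lower_semicontinuous f).

Definition recession_symmetric : Prop :=
  forall d, M *m d = 0 -> recession_direction f d -> recession_direction f (- d).

(** Otherwise <v, w + k d> - f(w + k d) would be unbounded in k. *)
Lemma fenchel_dom_dotp_le0 v d : edom (fenchel_conj f) v -> recession_direction f d ->
  dotp v d <= 0.
Proof.
move=> fv h; have [w fw] := fp.2.
have ub w' : edom f w' -> ((dotp v w' - fine (f w'))%:E <= fenchel_conj f v)%E.
  move=> fw'; rewrite EFinB -(edom_fineK fp.1 fw').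
  by apply: ereal_sup_ubound; exists w'.
have [c cE] : exists c, fenchel_conj f v = c%:E.
  exists (fine (fenchel_conj f v)); rewrite fineK // fin_numElt fv andbT.
  exact: lt_le_trans (ltNyr _) (ub _ fw).
rewrite leNgt; apply/negP => vd.
pose b := (c - dotp v w + fine (f w)) / dotp v d.
have [k hk] : exists k : nat, b < k%:R.
  by exists (Num.trunc b).+1; exact: truncnS_gt.
have [fk lek] := recession_direction_dom fp (recession_directionMn k h) fw.
have := ub _ fk; rewrite cE lee_fin dotpDr dotpZr.
by move: hk; rewrite ltr_pdivrMr //; lra.
Qed.

Lemma orthogonal_recession_symmetric (alpha : R) x0 v0 d : 0 <= alpha ->
  proper_convex alpha f ->
  strong_subgrad alpha f x0 v0 ->
  (forall x v, subdiff f x v -> dotp v d = 0) -> recession_direction f (- d).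
Proof.
move=> a0 fc /(strong_subgrad_subdiff a0 fp.1) s0 orth.
have f0 : proper_convex 0 f by exact: proper_convex_weaken fc.
have s0' := subdiff_strong_subgrad f0 s0.
apply: (orthogonal_recession_direction fp fl f0 s0') => x v sv.
by rewrite dotpNr (orth x) ?oppr0 //;
  exact: (strong_subgrad_subdiff (lexx 0) fp.1 sv).
Qed.

(** Under (B.1) and (B.2) the functional <., d> is nonpositive on the given set and vanishes at a
    relative interior point, since d is orthogonal to ran M^T. So it vanishes on all subgradients,
    and -d is a recession direction too. (B.3) is applied by contraposition, and (B.4) to (B.6)
    force d = 0. *)
Lemma qualification_recession_symmetric (alpha : R) x0 v0 :
  0 <= alpha -> proper_convex alpha f -> strong_subgrad alpha f x0 v0 ->
  relint (set_sub (edom (fenchel_conj f)) (ranmx M^T)) 0 \/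
  relint (\bigcup_x subdiff f x) `&` ranmx M^T !=set0 \/
  (forall x, (nullmx M `\` [set d | (- recession f (- d)%R)%E = 0%E /\
                                    recession f d = 0%E]) x ->
     (0 < recession f x)%E) \/
  coercive f \/ 0 < alpha \/ M^T *m M \in unitmx ->
  recession_symmetric.
Proof.
move=> a0 fc s0 B d Md hd.
have orth := orthogonal_recession_symmetric a0 fc s0.
have f0 : proper_convex 0 f by exact: proper_convex_weaken fc.
have MT y : dotp (M^T *m y) d = 0 by rewrite -dotp_mulmx Md dotp0r.
have zero : d = 0 -> recession_direction f (- d).
  by move=> ->; rewrite oppr0; exact: recession_direction0.
case: B => [B1|[[v [riv [y _ yE]]]|[B3|[B4|[B5|B6]]]]].
- apply: orth => x v sv; apply: (relint_dotp_eq0 B1); first by rewrite dotp0l.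
    by move=> _ [a fa [_ [y _ <-] <-]];
      rewrite dotpDl dotpNl MT subr0 fenchel_dom_dotp_le0.
  exists v; last by exists 0; [exists 0 => //; rewrite mulmx0|rewrite subr0].
  have [fx h] := sv.
  rewrite /edom /=; apply: (@le_lt_trans _ _ (dotp v x - fine (f x))%:E);
    last by rewrite ltry.
  apply: ge_ereal_sup => _ [w _ <-].
  have [fw|] := pselect (edom f w); last first.
    by rewrite /edom /= ltey => /negP/negPn/eqP ->; rewrite leNye.
  have := h w; rewrite (edom_fineK fp.1 fx) (edom_fineK fp.1 fw) -EFinB -EFinD
    !lee_fin.
  rewrite dotpC dotpDr dotpNr; lra.
- apply: orth => x w sw; apply: (relint_dotp_eq0 riv); first by rewrite -yE MT.
    move=> u [x' _ su]; apply: (recession_direction_dotp_le0 fp hd).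
    exact: (subdiff_strong_subgrad f0 su).
  by exists x.
- apply: contrapT => nd; have /B3 : (nullmx M `\` [set d |
      (- recession f (- d)%R)%E = 0%E /\ recession f d = 0%E]) d.
    split=> // -[h _]; apply: nd; apply/(recession_le0 fp).
    by rewrite -[recession _ _]oppeK h oppe0.
  by rewrite ltNge => /negP; apply; apply/(recession_le0 fp).
- exact/zero/(coercive_recession_direction fp B4).
- exact/zero/(strongly_convex_recession_direction fp B5 s0).
- by apply: zero; rewrite -[d]mul1mx -(mulVmx B6) -!mulmxA Md !mulmx0.
Qed.

(* Replacing each x_k by a nearly shortest point of x_k + S, where S is the set of
   directions of ker M along which f is constant, makes the sequence bounded: a
   limit of normalized points would be a direction in S, and moving against it
   would shorten the points by more than allowed. *)
Lemma strong_subgrad_attained_limit (U : set_system nat) (UU : UltraFilter U)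
    (x : nat -> 'cV[R]_n) (u : nat -> 'cV[R]_m) p u0 :
  proper_convex 0 f -> recession_symmetric ->
  (forall k, strong_subgrad 0 f (x k) (- (M^T *m u k))) ->
  M *m x k @[k --> U] --> p -> u @ U --> u0 ->
  exists2 x0, M *m x0 = p & strong_subgrad 0 f x0 (- (M^T *m u0)).
Proof.
move=> f0 sym sx Mxp uu0.
pose S s := [/\ M *m s = 0, recession_direction f s & recession_direction f (- s)].
have S0 : S 0 by split; rewrite ?mulmx0 ?oppr0 //; exact: recession_direction0.
have SD s t : S s -> S t -> S (s + t).
  move=> [s1 s2 s3] [t1 t2 t3]; split; first by rewrite mulmxDr s1 t1 addr0.
    exact: recession_directionD.
  by rewrite opprD; exact: recession_directionD.
have /choice[s hs] : forall k, exists s, S s /\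
    forall s', S s' -> enorm (x k + s) <= enorm (x k + s') + 1.
  move=> k; pose E := (fun s => enorm (x k + s)) @` S.
  have HE : has_inf E.
    split; first by exists (enorm (x k + 0)), 0.
    by exists 0 => _ [s _ <-]; exact: enorm_ge0.
  have [_ [s Ss <-] h] := inf_adherent ltr01 HE.
  exists s; split=> // s' Ss'; apply: (le_trans (ltW h)); rewrite lerD2r.
  by apply: (ge_inf HE.2); exists s'.
pose v k := x k + s k.
have Mv k : M *m v k = M *m x k by have [[h _ _] _] := hs k; rewrite mulmxDr h addr0.
(* The subgradient lies in ran M^T, so it sees only M v_k = M x_k, and f has not increased. *)
have sv k : strong_subgrad 0 f (v k) (- (M^T *m u k)).
  have [[Ms rs _] _] := hs k; have [fx hx] := sx k.
  have [fv lev] := recession_direction_dom fp rs fx.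
  split=> // w fw; have := hx _ fw; rewrite !dotpNl -!dotp_mulmx !mulmxBr Mv; lra.
have vmin k s' : S s' -> enorm (v k) <= enorm (v k + s') + 1.
  by move=> Ss'; have [Ss h] := hs k; rewrite /v -addrA; apply: h; exact: SD.
have [r vr] : exists r, \forall k \near U, enorm (v k) <= r; last first.
  have [x0 vx0] := bounded_ultra_cvg UU vr; exists x0.
    have h : M *m v k @[k --> U] --> M *m x0 by exact: cvg_mulmx.
    have h2 : M *m v k @[k --> U] --> p by under eq_fun do rewrite Mv.
    exact: (cvg_unique _ h h2).
  apply: (strong_subgrad_lim _ fp fl vx0 (u := fun k => - (M^T *m u k))).
    by apply: cvgN; exact: cvg_mulmx.
  by apply: nearW.
apply: contrapT => /forallNP unb.
have {}unb r : \forall k \near U, r < enorm (v k).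
  have [/unb//|] := in_ultra_setVsetC [set k | enorm (v k) <= r] UU.
  by apply: filterS => k /= /negP; rewrite -ltNge.
have V0 : (enorm (v k))^-1 @[k --> U] --> (0 : R).
  apply/cvgr0Pnorm_lt => e e0; move: (unb (e^-1)) (unb 0); apply: filterS2 => k ek k0.
  by rewrite ger0_norm ?invr_ge0 ?enorm_ge0 // invf_plt ?posrE.
pose e k := (enorm (v k))^-1 *: v k.
have [d ed] : exists d : 'cV[R]_n, e @ U --> d.
  apply: (@bounded_ultra_cvg _ _ _ UU _ _ 1); apply: filterS (unb 0) => k k0.
  by rewrite enormZ ger0_norm ?invr_ge0 ?enorm_ge0 // mulVf ?gt_eqF.
have Md : M *m d = 0.
  have h1 : M *m e k @[k --> U] --> M *m d by exact: cvg_mulmx.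
  have h2 : M *m e k @[k --> U] --> (0 : 'cV[R]_m).
    rewrite -(scale0r p); under eq_fun do rewrite -scalemxAr Mv.
    exact: cvgZ.
  exact: (cvg_unique _ h1 h2).
(* The subgradient inequality at a fixed w involves x_k only through M x_k, which converges; so
   f(v_k) stays bounded above although v_k does not. *)
have [L hL] : exists L, \forall k \near U, fine (f (v k)) <= L.
  have [w fw] := fp.2.
  have h : fine (f w) + dotp (u k) (M *m w - M *m x k) @[k --> U] -->
      fine (f w) + dotp u0 (M *m w - p).
    apply: cvgD; first exact: cvg_cst.
    by apply: cvg_dotp => //; apply: cvgB => //; exact: cvg_cst.
  exists (fine (f w) + dotp u0 (M *m w - p) + 1).
  have : \forall k \near U, fine (f w) + dotp (u k) (M *m w - M *m x k) <
      fine (f w) + dotp u0 (M *m w - p) + 1.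
    by apply: (cvgr_lt _ h); rewrite ltrDl.
  apply: filterS => k hk; have [_ /(_ _ fw)] := sv k.
  rewrite dotpNl -dotp_mulmx mulmxBr Mv !mul0r addr0; lra.
(* The point w + l_k (v_k - w) with l_k = t / |v_k| tends to w + t d, and by convexity its value
   exceeds f(w) by at most l_k (L - f(w)), which tends to 0. *)
have rd t : 0 < t -> recession_direction f (t *: d).
  move=> t0; apply/(recession_directionP fp) => w fw.
  pose l k := t * (enorm (v k))^-1.
  have l0 : l k @[k --> U] --> (0 : R).
    by rewrite -(mulr0 t); apply: cvgM => //; exact: cvg_cst.
  have xl : w + l k *: (v k - w) @[k --> U] --> w + t *: d.
    have -> : w + t *: d = w + (t *: d - 0 *: w) by rewrite scale0r subr0.
    apply: cvgD; first exact: cvg_cst.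
    under eq_fun do rewrite scalerBr -scalerA.
    by apply: cvgB; [apply: cvgZ => //; exact: cvg_cst|exact: cvgZr_tmp].
  have cl : fine (f w) + l k * (L - fine (f w)) @[k --> U] --> fine (f w).
    rewrite -[X in _ --> X]addr0 -(mul0r (L - fine (f w))).
    by apply: cvgD; [exact: cvg_cst|apply: cvgM => //; exact: cvg_cst].
  apply: (lsc_lim _ fp.1 fl xl cl).
  have : \forall k \near U, l k < 1 by apply: (cvgr_lt _ l0).
  move: hL (unb 0); apply: filterS3 => k kL k0 l1.
  have lk0 : 0 < l k by rewrite mulr_gt0 ?invr_gt0.
  have [fv _] := sv k.
  have [fs les] := proper_convex_segment f0 (introT andP (conj lk0 l1)) fw fv.
  split=> //; apply: (le_trans les); rewrite !mul0r subr0 lerD2l ler_pM2l //; lra.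
(* With |e_k - d| <= 1/2, the move by -|v_k| d at least halves the length. Near minimality up to 1
   then gives |v_k| <= |v_k|/2 + 1, against |v_k| > 2. *)
have : \forall k \near U, dotp (e k - d) (e k - d) < (2^-1) ^+ 2.
  have h : e k - d @[k --> U] --> d - d by apply: cvgB => //; exact: cvg_cst.
  by apply: (cvgr_lt _ (cvg_dotp h h)); rewrite subrr dotp0l exprn_gt0.
move=> near1; have [k [k1 k2]] := filter_ex (filterI near1 (unb 2)).
have k0 : 0 < enorm (v k) by apply: lt_trans k2.
have := vmin k (- (enorm (v k) *: d)) _.
have -> : v k + - (enorm (v k) *: d) = enorm (v k) *: (e k - d).
  by rewrite scalerBr /e scalerA divff ?gt_eqF // scale1r.
rewrite enormZ (ger0_norm (ltW k0)) => h.
have ek : enorm (e k - d) <= 2^-1 by rewrite enorm_le ?invr_ge0 // ltW.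
have : enorm (v k) <= enorm (v k) * enorm (e k - d) + 1.
  apply: h; split; first by rewrite mulmxN -scalemxAr Md scaler0 oppr0.
    by apply: sym; [rewrite -scalemxAr Md scaler0|exact: rd].
  by rewrite opprK; exact: rd.
have : enorm (v k) * enorm (e k - d) <= enorm (v k) * 2^-1 by rewrite ler_pM2l.
lra.
Qed.

End AttainedLimits.

(** * Fejér monotonicity and the admissible parameters *)

Section FejerMonotonicity.
Context {R : realType}.

Lemma fejer_gap_cvg0 (V w : nat -> R) : (forall k, 0 <= V k) ->
  (forall k, 0 <= w k) ->
  (forall k, V k.+1 + w k <= V k) -> w @ \oo --> (0 : R).
Proof.
move=> V0 w0 Vw.
have Vl : V @ \oo --> inf (range V).
  apply: nonincreasing_cvgn.
    by apply/nonincreasing_seqP => k; have := Vw k; have := w0 k; lra.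
  by exists 0 => _ [k _ <-].
apply: (@squeeze_cvgr _ _ _ _ (fun=> 0) (fun k => V k - V k.+1)).
- by apply: nearW => k; rewrite w0 /=; have := Vw k; lra.
- exact: cvg_cst.
- by rewrite -(subrr (inf (range V))); apply: cvgB => //; rewrite cvg_shiftS.
Qed.

(** The ultrafilter limit makes V small once, and monotonicity keeps it small. This upgrades the
    limit along the ultrafilter to convergence of the whole sequence. *)
Lemma nonincreasing_ultra_cvg0 (V : nat -> R) (U : set_system nat)
  (UU : UltraFilter U) :
  (forall k, 0 <= V k) -> (forall k, V k.+1 <= V k) ->
  V @ U --> (0 : R) -> V @ \oo --> (0 : R).
Proof.
move=> V0 Vd VU; apply/cvgr0Pnorm_lt => e e0.
have [N VN] : exists N, V N < e.
  have : \forall k \near U, V k < e by apply: (cvgr_lt _ VU).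
  by move=> /filter_ex.
have Vnd : nonincreasing_seq V by apply/nonincreasing_seqP.
near=> k; rewrite ger0_norm //; apply: le_lt_trans VN; apply: Vnd.
by near: k; exact: nbhs_infty_ge.
Unshelve. all: by end_near. Qed.

(* [a] stands for [alpha / |M|^2]. *)
Lemma parameter_form_coercive m (a beta delta gamma : R) :
  0 < delta + 2 * beta -> 0 <= a + beta ->
  (a + beta = 0 -> gamma = delta + 2 * beta) ->
  (0 < a + beta -> (gamma - (delta + 2 * beta)) ^+ 2 <
    2 * (a + beta) * (delta + 2 * beta)) ->
  exists2 c, 0 < c & forall z p : 'cV[R]_m,
    c * dotp (p - z) (p - z) <= (delta + 2 * beta) * dotp z z
      + (2 * a + 2 * gamma - delta) * dotp p p - 2 * gamma * dotp z p.
Proof.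
move=> A0 ab0 eq0 gt0.
have [ab|ab] := eqVneq (a + beta) 0.
  exists (delta + 2 * beta) => // z p; rewrite !dotpE (eq0 ab) [dotp p z]dotpC.
  have -> : a = - beta by lra.
  lra.
have abp : 0 < a + beta by rewrite lt_def ab.
set A := delta + 2 * beta in A0 eq0 gt0 *; set B := 2 * a + 2 * gamma - delta.
have D0 : 0 < A * B - gamma ^+ 2.
  by have := gt0 abp; rewrite /B /A; lra.
(* The best constant: 2 (a + beta) = A + B - 2 gamma, and this factor times the form, minus (A B -
   gamma^2) |p - z|^2, is exactly |(A - gamma) z + (B - gamma) p|^2. *)
exists ((A * B - gamma ^+ 2) / (2 * (a + beta)));
  first by rewrite divr_gt0 // mulr_gt0.
move=> z p; rewrite mulrAC ler_pdivrMr ?mulr_gt0 //.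
have := dotp_ge0 ((A - gamma) *: z + (B - gamma) *: p).
have -> : 2 * (a + beta) = A + B - 2 * gamma by rewrite /A /B; lra.
clearbody A B; rewrite !dotpE [dotp p z]dotpC; lra.
Qed.

(** z is the value of a resolvent of dg at y + delta z. Being Lipschitz, it lets z, and then y,
    inherit boundedness and convergence from s. *)
Lemma strong_subgrad_resolvent n (c delta : R) (g : 'cV[R]_n -> \bar R) z y z' y' :
  0 < c + delta -> strong_subgrad c g z y -> strong_subgrad c g z' y' ->
  enorm (z - z') <= (c + delta)^-1 * enorm ((y + delta *: z) - (y' + delta *: z')).
Proof.
move=> cd s s'; have := strong_subgrad_mono s s'.
have -> : (y + delta *: z) - (y' + delta *: z') = (y - y') + delta *: (z - z').
  by rewrite scalerBr opprD addrACA.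
move: (y - y') (z - z') => v w h.
have [->|w0] := eqVneq w 0.
  by rewrite enorm0 mulr_ge0 ?enorm_ge0 // invr_ge0 ltW.
rewrite ler_pdivlMl // -(ler_pM2r (enorm_gt0 w0)) -mulrA -expr2 enorm_sqr.
apply: le_trans (dotp_le_enorm _ _); rewrite dotpDl dotpZl; lra.
Qed.

(** With v = y - ys, w = z - M xs and p = M x - M xs, the decrease is 2 delta <v, w - p> + delta^2
    (|w|^2 - |p|^2). Monotonicity bounds <v, w> below and <v, p> above, and delta times the form of
    the hypothesis appears; alpha |x - xs|^2 is first weakened to alpha / |M|^2 |p|^2. *)
Lemma kkt_fejer m n (M : 'M[R]_(m, n)) f g (alpha beta gamma delta c : R)
    xs ys x z y :
  0 <= alpha -> M != 0 -> 0 < delta ->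
  (forall z p : 'cV[R]_m, c * dotp (p - z) (p - z) <= (delta + 2 * beta) * dotp z z
      + (2 * (alpha / opnorm M ^+ 2) + 2 * gamma - delta) * dotp p p
        - 2 * gamma * dotp z p) ->
  kkt M f g alpha beta xs ys -> strong_subgrad beta g z y ->
  strong_subgrad alpha f x (- (M^T *m (y + gamma *: (M *m x - z)))) ->
  let s := ys + delta *: (M *m xs) in
  dotp (y + delta *: (M *m x) - s) (y + delta *: (M *m x) - s)
    + delta * c * dotp (M *m x - z) (M *m x - z)
  <= dotp (y + delta *: z - s) (y + delta *: z - s).
Proof.
move=> a0 M0 d0 hc [sf sg] sz sx /=.
have M2 : 0 < opnorm M ^+ 2 by rewrite exprn_gt0 // opnorm_gt0.
have := strong_subgrad_mono sx sf.
have -> : - (M^T *m (y + gamma *: (M *m x - z))) - - (M^T *m ys) =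
    - (M^T *m ((y - ys) + gamma *: (M *m x - z))).
  by rewrite -opprD -mulmxBr addrAC.
rewrite dotpNl -dotp_mulmx mulmxBr => h1.
have h2 : alpha / opnorm M ^+ 2 * dotp (M *m x - M *m xs) (M *m x - M *m xs) <=
    alpha * dotp (x - xs) (x - xs).
  rewrite -mulrA ler_wpM2l // ler_pdivrMl // -mulmxBr; exact: dotp_mulmx_le.
have h3 := strong_subgrad_mono sz sg.
have E w : y + delta *: w - (ys + delta *: (M *m xs)) =
  (y - ys) + delta *: (w - M *m xs).
  by rewrite scalerBr opprD addrACA.
rewrite !E; have := hc (z - M *m xs) (M *m x - M *m xs).
have Ez : M *m x - z = (M *m x - M *m xs) - (z - M *m xs).
  by rewrite opprB addrA subrK.
rewrite -Ez; rewrite Ez in h1 *; move: h1 h2 h3.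
move: (M *m x - M *m xs) (z - M *m xs) (y - ys) => p w v.
set e := dotp (x - xs) _; clearbody e; set q := dotp (p - w) (p - w).
rewrite !dotpE [dotp p v]dotpC [dotp w v]dotpC => h1 h2 h3 h4.
have : delta * (c * q) <= delta * ((delta + 2 * beta) * dotp w w +
    (2 * (alpha / opnorm M ^+ 2) + 2 * gamma - delta) * dotp p p
      - 2 * gamma * dotp w p).
  by rewrite ler_pM2l.
have : delta * (alpha / opnorm M ^+ 2 * dotp p p + beta * dotp w w) <=
    delta * (dotp v w - (dotp v p + gamma * (dotp p p - dotp w p))).
  by rewrite ler_pM2l //; lra.
lra.
Qed.

End FejerMonotonicity.

(** * Inclusions satisfied by the two steps, and convergence of the iteration *)

Lemma x_step_strong_subgrad (R : realType) m n (M : 'M[R]_(m, n)) f (c gamma : R)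
    z y x :
  eproper f -> proper_convex c f -> x_step f M gamma z y x ->
  strong_subgrad c f x (- (M^T *m (y + gamma *: (M *m x - z)))).
Proof.
move=> fp fc xmin; have [x0 fx0] := fp.2.
have fx : edom f x.
  have := xmin x0; rewrite /aug_lagrangian !adde0 (edom_fineK fp.1 fx0) -EFinD.
  move=> h; have {h} := le_lt_trans h (ltry _); rewrite /edom /=.
  by move: (fp.1 x); case: (f x).
apply: penalized_min_strong_subgrad => // x' fx'.
have := xmin x'; rewrite /aug_lagrangian !adde0 (edom_fineK fp.1 fx)
  (edom_fineK fp.1 fx').
by rewrite -!EFinD lee_fin !enorm_sqr.
Qed.

Lemma z_step_strong_subgrad (R : realType) m n (M : 'M[R]_(m, n)) f g (c delta : R)
    x y z :
  (forall w, -oo < f w)%E -> edom f x -> eproper g -> proper_convex c g ->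
  minimizer (fun w => aug_lagrangian f g M delta x w y) z ->
  strong_subgrad c g z (y + delta *: (M *m x - z)).
Proof.
move=> fp fx gp gc zmin; have [z0 gz0] := gp.2.
have gz : edom g z.
  have := zmin z0; rewrite /aug_lagrangian (edom_fineK fp fx) (edom_fineK gp.1 gz0)
    -!EFinD.
  move=> h; have {h} := le_lt_trans h (ltry _); rewrite /edom /=.
  by move: (gp.1 z); case: (g z).
(* The z-step is a penalized problem with A = -1 and b = -M x, so that the residual keeps its
   sign. *)
have E w : (- 1%:M) *m w - (- (M *m x)) = M *m x - w.
  by rewrite mulNmx mul1mx opprK addrC.
have -> : y + delta *: (M *m x - z) =
    - ((- 1%:M)^T *m (y + delta *: ((- 1%:M) *m z - (- (M *m x))))).
  by rewrite E linearN /= trmx1 mulNmx mul1mx opprK.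
apply: penalized_min_strong_subgrad => // z' gz'; rewrite !E.
have := zmin z'; rewrite /aug_lagrangian (edom_fineK fp fx).
rewrite (edom_fineK gp.1 gz) (edom_fineK gp.1 gz') -!EFinD lee_fin !enorm_sqr; lra.
Qed.

Theorem corollary5p7 (R : realType) (m n : nat) (M : 'M[R]_(m, n))
  (f : 'cV[R]_n -> \bar R) (g : 'cV[R]_m -> \bar R) (alpha beta : R)
  (M_neq0 : M != 0)
  (f_proper : eproper f) (f_lsc : lower_semicontinuous f)
  (f_convex : alpha_convex alpha f)
  (g_proper : eproper g) (g_lsc : lower_semicontinuous g)
  (g_convex : alpha_convex beta g)
  (alpha_ge0 : 0 <= alpha)
  (alpha_beta_ge0 : 0 <= alpha + beta * opnorm M ^+ 2)
  (A : (* A.1 *) (exists x z y, critical_point f g M x z y) \/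
       (* A.2 *) (exists x z y, saddle_point f g M x z y) \/
       (* A.3 *) ((exists x z, optimal_solution f g M x z) /\
          relint (set_sub (edom g) [set M *m x | x in edom f]) 0))
  (B : (* B.1 *) relint (set_sub (edom (fenchel_conj f)) (ranmx M^T)) 0 \/
       (* B.2 *) relint (\bigcup_x subdiff f x) `&` ranmx M^T !=set0 \/
       (* B.3 *) (forall x,
          (nullmx M `\` [set d | (- recession f (- d)%R)%E = 0%E /\
                                 recession f d = 0%E]) x ->
          (0 < recession f x)%E) \/
       (* B.4 *) coercive f \/
       (* B.5 *) 0 < alpha \/
       (* B.6 *) M^T *m M \in unitmx)
  (delta gamma : R)
  (delta_gt : Num.max 0 (- (2 * beta)) < delta)
  (gamma_eq : alpha + beta * opnorm M ^+ 2 = 0 -> gamma = delta + 2 * beta)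
  (gamma_in : 0 < alpha + beta * opnorm M ^+ 2 ->
     Num.max 0 (delta + 2 * beta - Delta M alpha beta delta) < gamma /\
     gamma < delta + 2 * beta + Delta M alpha beta delta)
  (x : nat -> 'cV[R]_n) (z y : nat -> 'cV[R]_m)
  (xzy : aADMM f g M gamma delta x z y) :
  exists (xs : 'cV[R]_n) (zs ys : 'cV[R]_m),
    [/\ critical_point f g M xs zs ys,
        [/\ M *m x k @[k --> \oo] --> M *m xs,
            z k @[k --> \oo] --> zs
          & y k @[k --> \oo] --> ys],
        optimal_solution f g M xs zs
      & (0 < alpha \/ M^T *m M \in unitmx) -> x k @[k --> \oo] --> xs].
Proof.
move: delta_gt; rewrite gt_max => /andP[delta_gt0 delta_gt].
have A0 : 0 < delta + 2 * beta by lra.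
have bd0 : 0 < beta + delta by lra.
have fc := alpha_convex_proper f_proper f_convex.
have gc := alpha_convex_proper g_proper g_convex.
have fc0 := proper_convex_weaken alpha_ge0 fc.
have N0 := opnorm_gt0 M_neq0; have N2 : 0 < opnorm M ^+ 2 by rewrite exprn_gt0.
have [xs [ys kkts]] : exists xs ys, kkt M f g alpha beta xs ys.
  case: A => [[x0 [z0 [y0 h]]]|[[x0 [z0 [y0 h]]]|[[x0 [z0 h]] ri]]].
  - by exists x0, y0; exact: critical_point_kkt h.
  - by exists x0, y0; exact: saddle_point_kkt h.
  - by exists x0; exact: qualified_optimal_kkt h ri.
have sym := qualification_recession_symmetric f_proper f_lsc alpha_ge0 fc kkts.1 B.
have [c c0 hc] : exists2 c, 0 < c & forall z p : 'cV[R]_m,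
    c * dotp (p - z) (p - z) <= (delta + 2 * beta) * dotp z z
      + (2 * (alpha / opnorm M ^+ 2) + 2 * gamma - delta) * dotp p p
        - 2 * gamma * dotp z p.
  have E : alpha + beta * opnorm M ^+ 2 =
    (alpha / opnorm M ^+ 2 + beta) * opnorm M ^+ 2.
    by rewrite mulrDl divfK // gt_eqF.
  apply: parameter_form_coercive => //.
  - by move: alpha_beta_ge0; rewrite E pmulr_lge0.
  - by move=> h; apply: gamma_eq; rewrite E h mul0r.
  - move=> h; have [] := gamma_in _; first by rewrite E mulr_gt0.
    rewrite gt_max => /andP[_ g1] g2.
    have D0 : 0 <= Delta M alpha beta delta by lra.
    have -> : 2 * (alpha / opnorm M ^+ 2 + beta) * (delta + 2 * beta) =
        Delta M alpha beta delta ^+ 2.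
      rewrite /Delta E exprMn sqr_sqrtr; first by field; rewrite gt_eqF.
      by rewrite mulr_ge0 ?(ltW A0) // mulr_ge0 // mulr_ge0 ?ltW.
    rewrite -real_normK ?num_real // ltr_pXn2r ?nnegrE // ltr_norml; lra.
(* Since z^0 and y^0 are arbitrary, y^k is a subgradient of g at z^k only from k = 1 on; hence the
   shifts, with x starting at index 2. *)
pose u k := y k.+1 + gamma *: (M *m x k.+2 - z k.+1).
have sx k : strong_subgrad alpha f (x k.+2) (- (M^T *m u k)).
  by have [h _ _] := xzy k.+1; exact: x_step_strong_subgrad h.
have fx k : edom f (x k.+1).
  by have [h _ _] := xzy k; have [] := x_step_strong_subgrad f_proper fc h.
have sz k : strong_subgrad beta g (z k.+1) (y k.+1).
  have [_ h ->] := xzy k; exact: z_step_strong_subgrad (f_proper.1) (fx k) g_proper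
    gc h.
pose s k := y k.+1 + delta *: z k.+1.
have sE k : s k.+1 = y k.+1 + delta *: (M *m x k.+2).
  by rewrite /s; have [_ _ ->] := xzy k.+1; rewrite -addrA -scalerDr subrK.
have fejer x' y' : kkt M f g alpha beta x' y' -> let s' := y' + delta *: (M *m x') in
    forall k, dotp (s k.+1 - s') (s k.+1 - s') +
      delta * c * dotp (M *m x k.+2 - z k.+1) (M *m x k.+2 - z k.+1) <=
        dotp (s k - s') (s k - s').
  by move=> h s' k; rewrite sE;
    exact: (kkt_fejer alpha_ge0 M_neq0 delta_gt0 hc h (sz k) (sx k)).
have dc0 : 0 < delta * c by rewrite mulr_gt0.
have decr x' y' k : kkt M f g alpha beta x' y' -> let s' := y' + delta *: (M *m x') in
    dotp (s k.+1 - s') (s k.+1 - s') <= dotp (s k - s') (s k - s').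
  move=> /fejer/(_ k)/= h; apply: le_trans h.
  by rewrite lerDl mulr_ge0 ?dotp_ge0 ?ltW.
pose gap k := M *m x k.+2 - z k.+1.
have gap0 : gap @ \oo --> (0 : 'cV[R]_m).
  have := @fejer_gap_cvg0 _
    (fun k => dotp (s k - (ys + delta *: (M *m xs)))
      (s k - (ys + delta *: (M *m xs))))
    (fun k => delta * c * dotp (gap k) (gap k)).
  move=> /(_ (fun k => dotp_ge0 _) (fun k => mulr_ge0 (ltW dc0) (dotp_ge0 _))
    (fejer _ _ kkts)) h.
  apply/cvg_dotpP; rewrite -(mulr0 (delta * c)^-1).
  under eq_fun => k do rewrite subr0 -[dotp _ _](mulKf (lt0r_neq0 dc0)).
  by apply: cvgM => //; exact: cvg_cst.
have [U [UU ooU]] := @ultraFilterLemma _ (\oo : set_system nat) _.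
have sb k : enorm (s k - (ys + delta *: (M *m xs))) <=
  enorm (s 0%N - (ys + delta *: (M *m xs))).
  elim: k => [|k IH]; first exact: lexx.
  apply: (le_trans _ IH).
  by rewrite enorm_le ?enorm_ge0 // enorm_sqr; exact: decr kkts.
have [s0 sU] : exists s0 : 'cV[R]_m, s @ U --> s0.
  apply: (@bounded_ultra_cvg _ _ _ UU _ _
    (enorm (s 0%N - (ys + delta *: (M *m xs))) + enorm (ys + delta *: (M *m xs)))).
  apply: nearW => k; rewrite -[s k](subrK (ys + delta *: (M *m xs))).
  by apply: (le_trans (enormD _ _)); rewrite lerD2r.
have [z0 zU] : exists z0 : 'cV[R]_m, z k.+1 @[k --> U] --> z0.
  apply: (@bounded_ultra_cvg _ _ _ UU _ _
    ((beta + delta)^-1 * enorm (s 0%N - (ys + delta *: (M *m xs)))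
      + enorm (M *m xs))).
  apply: nearW => k; rewrite -[z k.+1](subrK (M *m xs)).
  apply: (le_trans (enormD _ _)); rewrite lerD2r.
  apply: (le_trans (strong_subgrad_resolvent bd0 (sz k) kkts.2)).
  by rewrite ler_pM2l ?invr_gt0 //; exact: sb.
have yE k : y k.+1 = s k - delta *: z k.+1 by rewrite /s addrK.
pose y0 := s0 - delta *: z0.
have yU : y k.+1 @[k --> U] --> y0.
  under eq_fun do rewrite yE.
  exact: (cvgB sU (cvgZ (cvg_cst delta) zU)).
have gapU : gap @ U --> (0 : 'cV[R]_m) by apply: cvg_trans gap0; exact: cvg_app.
have pE k : M *m x k.+2 = gap k + z k.+1 by rewrite /gap subrK.
have pU : M *m x k.+2 @[k --> U] --> z0.
  by rewrite -[z0]add0r; under eq_fun do rewrite pE; exact: (cvgD gapU zU).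
have uU : u @ U --> y0.
  by rewrite -[y0]addr0 -(scaler0 _ gamma);
    exact: (cvgD yU (cvgZ (cvg_cst gamma) gapU)).
have [x0 Mx0 sx0] := strong_subgrad_attained_limit f_proper f_lsc UU fc0 sym
  (fun k => subdiff_strong_subgrad fc0
    (strong_subgrad_subdiff alpha_ge0 f_proper.1 (sx k))) pU uU.
have kkt0 : kkt M f g alpha beta x0 y0.
  split; first exact: (strong_subgrad_upgrade fc (lexx 0) sx0).
  rewrite Mx0; apply: (strong_subgrad_lim _ g_proper g_lsc zU yU).
  by apply: nearW => k; exact: sz.
have s0E : y0 + delta *: (M *m x0) = s0 by rewrite Mx0 subrK.
(* Fejér monotonicity is now applied with the cluster point itself as reference. *)
have soo : s @ \oo --> s0.
  apply/cvg_dotpP; apply: (nonincreasing_ultra_cvg0 UU) => [k|k|].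
  - exact: dotp_ge0.
  - by have := decr _ _ k kkt0; rewrite /= s0E.
  - exact/cvg_dotpP.
have zoo : z k.+1 @[k --> \oo] --> z0.
  apply/cvg_dotpP.
  have h : (beta + delta)^-1 ^+ 2 * dotp (s k - s0) (s k - s0) @[k --> \oo] -->
    (0 : R).
    rewrite -(mulr0 ((beta + delta)^-1 ^+ 2)).
    by apply: cvgM; [exact: cvg_cst|apply/cvg_dotpP].
  apply: (squeeze_cvgr _ (cvg_cst 0) h); apply: nearW => k.
  rewrite dotp_ge0 /= -!enorm_sqr -exprMn ler_pXn2r ?nnegrE ?enorm_ge0 //; last first.
    by rewrite mulr_ge0 ?enorm_ge0 // invr_ge0 ltW.
  by rewrite -s0E -Mx0; apply: strong_subgrad_resolvent (sz k) kkt0.2.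
have yoo : y k.+1 @[k --> \oo] --> y0.
  under eq_fun do rewrite yE.
  exact: (cvgB soo (cvgZ (cvg_cst delta) zoo)).
have poo : M *m x k.+2 @[k --> \oo] --> M *m x0.
  by rewrite Mx0 -[z0]add0r; under eq_fun do rewrite pE; exact: (cvgD gap0 zoo).
have shift2 p (v : nat -> 'cV[R]_p) (l : 'cV[R]_p) :
    v k.+2 @[k --> \oo] --> l -> v @ \oo --> l.
  by move=> h; rewrite -cvg_shiftS -(cvg_shiftS (fun k => v k.+1)).
have Mxoo : M *m x k @[k --> \oo] --> M *m x0.
  exact: (shift2 _ (fun k => M *m x k)).
exists x0, (M *m x0), y0; split.
- exact: (kkt_critical_point f_proper g_proper alpha_ge0 kkt0).
- split; [exact: Mxoo| |by rewrite -(cvg_shiftS y); exact: yoo].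
  by rewrite -(cvg_shiftS z) Mx0; exact: zoo.
- exact: (kkt_optimal f_proper g_proper alpha_ge0 alpha_beta_ge0 kkt0).
case=> [a0|MM]; last first.
  (* Invertibility of M^T M recovers x continuously from M x. *)
  have xE k : x k = invmx (M^T *m M) *m M^T *m (M *m x k).
    by rewrite -mulmxA [M^T *m (M *m _)]mulmxA mulKmx.
  have -> : x0 = invmx (M^T *m M) *m M^T *m (M *m x0).
    by rewrite -mulmxA [M^T *m (M *m _)]mulmxA mulKmx.
  by under eq_fun do rewrite xE; exact: cvg_mulmx.
apply: shift2; apply/cvg_dotpP.
have uoo : u @ \oo --> y0.
  rewrite -[y0]addr0 -(scaler0 _ gamma).
  exact: (cvgD yoo (cvgZ (cvg_cst gamma) gap0)).
(* Strong monotonicity of df bounds alpha |x_(k+2) - x0|^2 by this inner product, both of whose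
   factors tend to 0. *)
have h : alpha^-1 * dotp (y0 - u k) (M *m x k.+2 - M *m x0) @[k --> \oo] --> (0 : R).
  rewrite -(mulr0 alpha^-1) -(dotp0l (0 : 'cV[R]_m)) -[in dotp 0](subrr y0)
    -(subrr (M *m x0)).
  apply: cvgM; first exact: cvg_cst.
  exact: (cvg_dotp (cvgB (cvg_cst y0) uoo) (cvgB poo (cvg_cst (M *m x0)))).
apply: (squeeze_cvgr _ (cvg_cst 0) h); apply: nearW => k.
rewrite dotp_ge0 /= ler_pdivlMl // -mulmxBr dotp_mulmx mulmxBr.
have := strong_subgrad_mono (sx k) kkt0.1.
by rewrite opprK [- _ + _]addrC.
Qed.
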